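(* Let $n\geq 2$ be an integer and let $p,q\in[1,+\infty)$. \begin{itemize} \item Suppose $p=q$. Let $\mu$ and $\rho$ be two probability measures on $\mathbb{R}^n$ sharing the same copula $C$. Then $\nu=\mu\diamond\rho$ is an optimal coupling between $\mu$ and $\rho$, i.e. it attains the infimum defining $\mathcal{W}_{p,p}(\mu,\rho)$, and $$\mathcal{W}^p_{p,p}(\mu,\rho)=\int_{[0,1]^n}\sum_{i=1}^n|F_{\mu_i}^{-1}(u_i)-F_{\rho_i}^{-1}(u_i)|^p\, dC(u_1,\ldots,u_n)=\int_{[0,1]}\sum_{i=1}^n|F_{\mu_i}^{-1}(u)-F_{\rho_i}^{-1}(u)|^p\,du.$$ \item Suppose $p\neq q$. Then the coupling $\mu\diamond\rho$ is in general no longer optimal, in the following sense. Let $C$ be an $n$-dimensional copula, and assume either that $p<q$ and $C\neq C_n^+$, or that $p>q$ and ($n\geq 3$, or $n=2$ and $C\neq C_2^-$). Then there exist probability measures $\mu$ and $\rho$ on $\mathbb{R}^n$, each admitting $C$ as its unique copula, such that $$\left(\int_{\mathbb{R}^n\times\mathbb{R}^n}\|x-y\|_q^p\;\mu\diamond\rho(dx,dy)\right)^{1/p}>\mathcal{W}_{p,q}(\mu,\rho).$$ \end{itemize}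
   Context: For $q\in[1,+\infty)$, $\mathbb{R}^n$ is endowed with the norm $\|(x_1,\ldots,x_n)\|_q=\left(\sum_{i=1}^n|x_i|^q\right)^{1/q}$. A coupling of two probability measures $\mu$ and $\rho$ on $\mathbb{R}^n$ is a probability measure $\nu$ on $\mathbb{R}^n\times\mathbb{R}^n$ with first marginal $\mu$ and second marginal $\rho$. For $p,q\in[1,+\infty)$, $$\mathcal{W}_{p,q}(\mu,\rho)=\inf_{\nu}\left(\int_{\mathbb{R}^n\times\mathbb{R}^n}\|x-y\|_q^p\,\nu(dx,dy)\right)^{1/p}\in[0,+\infty],$$ where the infimum runs over all couplings $\nu$ of $\mu$ and $\rho$. For a probability measure $\mu$ on $\mathbb{R}^n$, $\mu_i$ denotes its $i$-th marginal (the image of $\mu$ by $(x_1,\ldots,x_n)\mapsto x_i$). For a probability measure $\eta$ on $\mathbb{R}$ and $u\in(0,1)$, $F_\eta^{-1}(u)=\inf\{x\in\mathbb{R}:\eta((-\infty,x])\geq u\}$. An ($n$-dimensional) copula is a function $C:[0,1]^n\to[0,1]$ of the form $C(u_1,\ldots,u_n)=m\left(\prod_{i=1}^n[0,u_i]\right)$ for some probability measure $m$ on $[0,1]^n$ all of whose one-dimensional marginals are the Lebesgue measure on $[0,1]$; this probability measure $m$ is denoted by $dC$. A probability measure $\mu$ on $\mathbb{R}^n$ admits $C$ as a copula if $$\mu\left(\prod_{i=1}^n(-\infty,x_i]\right)=C\left(\mu_1((-\infty,x_1]),\ldots,\mu_n((-\infty,x_n])\right)\quad\text{for all }(x_1,\ldots,x_n)\in\mathbb{R}^n.$$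 It admits $C$ as its unique copula if in addition no other copula satisfies this identity. Two probability measures $\mu,\rho$ share the same copula $C$ if both admit $C$ as a copula. When $\mu$ and $\rho$ share the copula $C$, $\mu\diamond\rho$ denotes the probability measure on $\mathbb{R}^{2n}=\mathbb{R}^n\times\mathbb{R}^n$ which is the image of $dC$ by $$(u_1,\ldots,u_n)\mapsto\left(F_{\mu_1}^{-1}(u_1),\ldots,F_{\mu_n}^{-1}(u_n),F_{\rho_1}^{-1}(u_1),\ldots,F_{\rho_n}^{-1}(u_n)\right)$$ (defined $dC$-almost everywhere, namely on $(0,1)^n$). Finally, $C_n^+(u_1,\ldots,u_n)=\min(u_1,\ldots,u_n)$ and $C_2^-(u_1,u_2)=(u_1+u_2-1)^+$, where $x^+=\max(x,0)$. *)

(* Defs.v *)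
From HB Require Import structures.
From mathcomp Require Import all_boot all_order all_algebra.
From mathcomp Require Import all_classical all_reals all_analysis.
From mathcomp Require Import measurable_realfun.

Set Implicit Arguments.
Unset Strict Implicit.
Unset Printing Implicit Defensive.
Import Order.TTheory GRing.Theory Num.Theory.
Import numFieldNormedType.Exports.

Local Open Scope classical_set_scope.
Local Open Scope ring_scope.

(* R^n is n.-tuple R with the product sigma-algebra, which is the Borel one. *)

Definition coord (R : realType) (n : nat) (i : 'I_n) (x : n.-tuple R) : R :=
  tnth x i.

HB.instance Definition _ (R : realType) (n : nat) (i : 'I_n) :=
  @isMeasurableFun.Build _ _ _ _ (@coord R n i) (@measurable_tnth _ R n i).

Definition marginal (R : realType) (n : nat) (mu : probability (n.-tuple R) R)
  (i : 'I_n) : probability R R := distribution mu (coord i).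

Definition lnorm (R : realType) (n : nat) (q : R) (x : n.-tuple R) : R :=
  (\sum_(i < n) `|tnth x i| `^ q) `^ q^-1.

Definition is_coupling (R : realType) (n : nat)
    (mu rho : probability (n.-tuple R) R)
    (nu : probability (n.-tuple R * n.-tuple R)%type R) : Prop :=
  forall A : set (n.-tuple R), measurable A ->
    pushforward nu fst A = mu A /\ pushforward nu snd A = rho A.

Definition transport_cost (R : realType) (n : nat) (p q : R)
    (nu : probability (n.-tuple R * n.-tuple R)%type R) : \bar R :=
  ((\int[nu]_z
     (lnorm q [tuple tnth z.1 i - tnth z.2 i | i < n] `^ p)%:E) `^ p^-1)%E.

Definition wasserstein (R : realType) (n : nat) (p q : R)
    (mu rho : probability (n.-tuple R) R) : \bar R :=
  ereal_inf [set transport_cost p q nu | nu in is_coupling mu rho].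

(* The generalized inverse F_eta^{-1}; it is only meaningful on ]0, 1[ since inf
   is total with junk values on empty or unbounded sets. *)
Definition quantile (R : realType) (eta : probability R R) (u : R) : R :=
  inf [set x : R | (u%:E <= eta `]-oo, x]%classic)%E].

Definition unit_cube (R : realType) (n : nat) : set (n.-tuple R) :=
  [set u | forall i, 0 <= tnth u i <= 1].
Arguments unit_cube {R} n.

(* A probability measure on [0, 1]^n is encoded as one on R^n: the condition on
   the marginals forces it to be carried by the cube.  The values of copula_fun
   outside the cube are irrelevant, so copulas are only compared on it.
   By the pi-lambda theorem dcopula is determined by copula_fun. *)
Record copula (R : realType) (n : nat) := Copula {
  copula_fun :> n.-tuple R -> R;
  dcopula : probability (n.-tuple R) R;
  dcopula_marginal : forall (i : 'I_n) (A : set R), measurable A ->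
    marginal dcopula i A = lebesgue_measure (A `&` `[0, 1]);
  copula_funE : forall u : n.-tuple R, unit_cube n u ->
    (copula_fun u)%:E =
    dcopula [set x | forall i, 0 <= tnth x i <= tnth u i] }.

Definition has_copula (R : realType) (n : nat)
    (mu : probability (n.-tuple R) R) (C : copula R n) : Prop :=
  forall x : n.-tuple R,
    mu [set y | forall i, tnth y i <= tnth x i] =
    (C [tuple fine (marginal mu i `]-oo, tnth x i]%classic) | i < n])%:E.

Definition has_unique_copula (R : realType) (n : nat)
    (mu : probability (n.-tuple R) R) (C : copula R n) : Prop :=
  has_copula mu C /\
  forall C' : copula R n, has_copula mu C' -> {in unit_cube n, C' =1 C}.

(* The neutral value 1 is harmless on the unit cube when n > 0. *)
Definition copula_plus (R : realType) (n : nat) (u : n.-tuple R) : R :=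
  \big[Num.min/1]_(i < n) tnth u i.

(* C_2^-; typed for arbitrary n, but only meant to be used for n = 2. *)
Definition copula2_minus (R : realType) (n : nat) (u : n.-tuple R) : R :=
  Num.max (u`_0 + u`_1 - 1) 0.

Lemma quantile_homo (R : realType) (eta : probability R R) :
  {in `]0, 1[ &, {homo quantile eta : u v / u <= v}}.
Proof.
move=> u v; rewrite !in_itv/= => /andP[u0 u1] /andP[v0 v1] uv.
pose X : {mfun R >-> R} := HB.pack (idfun : R -> R)
  (@isMeasurableFun.Build _ _ _ _ (idfun : R -> R) (@measurable_id _ R setT)).
have cdfE x : cdf (P := eta) X x = eta `]-oo, x]%classic by [].
have Sv : exists x, (v%:E <= eta `]-oo, x]%classic)%E.
  have /(_ _)/= h := @cvg_cdfy1 _ _ _ eta X.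
  have /h [M [_ hM]] : nbhs (1%E : \bar R) [set y | (v%:E < y)%E].
    by apply: open_nbhs_nbhs; split; [exact: open_ereal_gt_ereal|rewrite /= lte_fin].
  by exists (M + 1); apply/ltW; apply: hM; rewrite ltrDl.
have Su : exists m, forall x, (u%:E <= eta `]-oo, x]%classic)%E -> m <= x.
  have /(_ _)/= h := @cvg_cdfNy0 _ _ _ eta X.
  have /h [M [_ hM]] : nbhs (0%E : \bar R) [set y | (y < u%:E)%E].
    by apply: open_nbhs_nbhs; split; [exact: open_ereal_lt_ereal|rewrite /= lte_fin].
  exists M => x ux; rewrite leNgt; apply/negP => /hM/=.
  by rewrite cdfE ltNge ux.
rewrite /quantile; apply: lb_le_inf; first by case: Sv => x ?; exists x.
move=> x /= vx; apply: ge_inf; last by rewrite /= (le_trans _ vx)// lee_fin.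
by case: Su => m hm; exists m => y /= /hm.
Qed.

Lemma measurable_quantile (R : realType) (eta : probability R R) :
  measurable_fun [set: R] (quantile eta).
Proof.
have cst_in (D : set R) c : (forall u, D u -> quantile eta u = c) ->
    measurable_fun D (quantile eta).
  move=> h; apply: (eq_measurable_fun (cst c)); last exact: measurable_cst.
  by move=> u; rewrite inE => /h.
have -> : [set: R] = `]-oo, 0] `|` (`]0, 1[ `|` (`[1, 1] `|` `]1, +oo[)).
  apply/seteqP; split => // u _ /=; rewrite !in_itv/= !andbT.
  have [u0|u0] := leP u 0; [by left|right].
  have [u1|u1] := ltP u 1; [by left|right].
  have [->|neq] := eqVneq u 1; first by left; rewrite lexx.
  by right; rewrite lt_neqAle eq_sym neq.
have m1 : measurable_fun `]-oo, (0:R)] (quantile eta).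
  apply: (cst_in _ (inf setT)) => u /=; rewrite in_itv/= => u0.
  congr inf; apply/seteqP; split => // x _ /=.
  by rewrite (@le_trans _ _ 0%E)// lee_fin.
have m3 : measurable_fun `[(1:R), 1] (quantile eta).
  apply: (cst_in _ (quantile eta 1)) => u /=.
  by rewrite in_itv/= -eq_le => /eqP ->.
have m4 : measurable_fun `](1:R), +oo[ (quantile eta).
  apply: (cst_in _ (inf set0)) => u /=; rewrite in_itv/= andbT => u1.
  congr inf; apply/seteqP; split => // x /= ux.
  have : (u%:E <= 1)%E by apply: (le_trans ux); exact: probability_le1.
  by rewrite lee_fin leNgt u1.
have m2 : measurable_fun `](0:R), 1[ (quantile eta).
  apply: (measurability (@RGenCInfty.G R)) => [|/= _ [_] [r] -> <-].
    exact: RGenCInfty.measurableE.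
  apply: is_interval_measurable => s t /= [Ds fs] [Dt ft] u /andP[su ut].
  have Du : u \in `]0, 1[.
    move: (Ds) (Dt); rewrite !in_itv/= => /andP[s0 _] /andP[_ t1].
    by rewrite (lt_le_trans s0 su) (le_lt_trans ut t1).
  split => //; move: fs; rewrite !in_itv/= !andbT => rs.
  by apply: (le_trans rs); exact: quantile_homo.
have mU (A B : set R) : measurable A -> measurable B ->
    measurable_fun A (quantile eta) -> measurable_fun B (quantile eta) ->
    measurable_fun (A `|` B) (quantile eta).
  by move=> mA mB fA fB; apply/measurable_funU.
have m34 := mU _ _ (measurable_itv _) (measurable_itv _) m3 m4.
have mI34 : measurable (`[(1:R), 1] `|` `]1, +oo[) by exact: measurableU.
apply: (mU) => //; first exact: measurableU.
by apply: (mU).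
Qed.

Definition quantile_pair (R : realType) (n : nat)
    (mu rho : probability (n.-tuple R) R) (u : n.-tuple R) :
    n.-tuple R * n.-tuple R :=
  ([tuple quantile (marginal mu i) (tnth u i) | i < n],
   [tuple quantile (marginal rho i) (tnth u i) | i < n]).

Lemma measurable_quantile_pair (R : realType) (n : nat)
    (mu rho : probability (n.-tuple R) R) :
  measurable_fun [set: n.-tuple R] (quantile_pair mu rho).
Proof.
have h (m : probability (n.-tuple R) R) : measurable_fun [set: n.-tuple R]
    (fun u : n.-tuple R =>
      [tuple quantile (marginal m i) (tnth u i) | i < n]).
  apply/measurable_fun_tnthP => i.
  rewrite (_ : _ \o _ = quantile (marginal m i) \o coord i); last first.
    by apply/funext => u /=; rewrite tnth_mktuple.
  by apply: measurableT_comp; [exact: measurable_quantile|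
    exact: measurable_tnth].
exact: measurable_fun_pair.
Qed.

HB.instance Definition _ (R : realType) (n : nat)
    (mu rho : probability (n.-tuple R) R) :=
  @isMeasurableFun.Build _ _ _ _ (quantile_pair mu rho)
    (measurable_quantile_pair mu rho).

Definition diamond (R : realType) (n : nat)
    (mu rho : probability (n.-tuple R) R) (C : copula R n) :
    probability (n.-tuple R * n.-tuple R)%type R :=
  distribution (dcopula C) (quantile_pair mu rho).

(* Main.v *)
Require Import Defs.
From HB Require Import structures.
From mathcomp Require Import all_boot all_order all_algebra.
From mathcomp Require Import all_classical all_reals all_analysis.
From mathcomp Require Import measurable_realfun ring lra.
Import Order.TTheory GRing.Theory Num.Theory.
Import numFieldNormedType.Exports.
Local Open Scope classical_set_scope.
Local Open Scope ring_scope.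

(* p = q: the cost is a sum over coordinates, so each coordinate is a
   one-dimensional transport problem, and the diamond couples the coordinates
   monotonically.  In dimension one,
     |x - y|^p = int_s k(x, y, s) ds + int_s k(y, x, s) ds
   with k(x, y, s) = 1_{x <= s <= y} p (y - s)^(p - 1); by the layer cake
   formula the integral of k under a coupling of X and Y is a mixture of
   probabilities P(X <= s, Y in U) with U an upper set, and the monotone
   coupling minimizes all of them at once (Frechet's bound).  This needs no
   integrability.

   p <> q: for any copula, let U have law dC, take mu close to the law of
   (1_{U_0 > 1/2}, 0, ..., 0) and rho close to the law of (0, G, 0, ..., 0) with
   G = 1_{U_1 > 1/2} or G = - 1_{U_1 <= 1/2}; adding e U_i to every coordinate
   makes the marginal maps strictly increasing, hence C the unique copula.  As
   e -> 0 the p-th power of the cost of a coupling becomes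
   1 + (2^(p/q) - 2) r, with r in [0, 1/2] the probability that both
   indicators are nonzero.  The choice of G puts the r of the diamond on the bad
   side of 1/4, and conditioning a product measure gives a coupling with r = 1/2
   (p < q) or r = 0 (p > q). *)

Set Implicit Arguments.
Unset Strict Implicit.
Unset Printing Implicit Defensive.

(** * Orthants and copulas *)

(** Serves to discard exceptional values such as 0, 1 and the ends of intervals, where boxes and
    quantile functions may disagree. *)
Lemma measure_eq_off_null d (T : measurableType d) (R : realType)
    (mu : {measure set T -> \bar R}) (N A B : set T) :
  measurable N -> measurable A -> measurable B -> mu N = 0%E ->
  A `\` N = B `\` N -> mu A = mu B.
Proof.
move=> mN mA mB N0 AB.
have h D : measurable D -> mu D = mu (D `\` N).
  move=> mD.
  have mDN : measurable (D `&` N) by exact: measurableI.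
  have mDN' : measurable (D `\` N) by exact: measurableD.
  have DN0 : D `&` N `&` (D `\` N) = set0 by rewrite setDE setIACA setICr setI0.
  have := measureU mu mDN mDN' DN0; rewrite setUIDK => ->.
  have DN : mu (D `&` N) = 0%E.
    by apply/eqP; rewrite -measure_le0 -N0; apply: le_measure; rewrite ?inE.
  by rewrite -[RHS]add0e; congr (_ + _)%E.
by rewrite (h A)// (h B)// AB.
Qed.

Section orthants.
Context (R : realType) (n : nat).

(** The set whose measure appears on the left of the identity in [has_copula]. *)
Definition orthant (x : n.-tuple R) : set (n.-tuple R) :=
  [set y | forall i, tnth y i <= tnth x i].

Lemma measurable_box (I : 'I_n -> set R) : (forall i, measurable (I i)) ->
  measurable [set u : n.-tuple R | forall i, I i (tnth u i)].
Proof.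
move=> mI.
rewrite (_ : [set u | _] = \bigcap_(i in [set: 'I_n]) (Defs.coord i @^-1` I i)).
  apply: fin_bigcap_measurable => // i _.
  by rewrite -[X in measurable X]setTI; exact: measurable_tnth.
by apply/seteqP; split => [u h i _|u h i]; [exact: h|exact: (h i)].
Qed.

Lemma measurable_box_exists (N : 'I_n -> set R) : (forall i, measurable (N i)) ->
  measurable [set u : n.-tuple R | exists i, N i (tnth u i)].
Proof.
move=> mN.
rewrite (_ : [set u | _] = ~` [set u | forall i, (~` N i) (tnth u i)]).
  apply: measurableC; apply: (measurable_box (I := fun i => ~` N i)) => i.
  exact: measurableC.
apply/seteqP; split=> u /=; first by move=> [i Ni] /(_ i).
by move=> /existsNP[i /contrapT Ni]; exists i.
Qed.

Lemma measurable_orthant x : measurable (orthant x).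
Proof.
rewrite (_ : orthant x =
  [set y | forall i, `]-oo, tnth x i]%classic (tnth y i)]).
  apply: (@measurable_box (fun i => `]-oo, tnth x i]%classic)) => i.
  exact: measurable_itv.
by apply/seteqP; split => y h i; have := h i; rewrite /= in_itv.
Qed.

(** Besides the measurability of orthants, it suffices that each coordinate is measurable for the
    generated sigma-algebra: [{u_i <= r}] is the union over k of the orthants with bound r at i and
    bound k elsewhere. *)
Lemma measurable_tuple_orthant :
  @measurable _ (n.-tuple R) = <<s range orthant >>.
Proof.
apply/seteqP; split; last first.
  apply: smallest_sub; first exact: sigma_algebra_measurable.
  by move=> _ [x _ <-]; exact: measurable_orthant.
pose T' := g_sigma_algebraType (range orthant).
have mO (x : n.-tuple R) : measurable (orthant x : set T').
  by apply: sub_sigma_algebra; exists x.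
suff h (i : 'I_n) : measurable_fun [set: T'] (fun u : T' => tnth (u : n.-tuple R) i).
  have /measurable_fun_tnthP mid : forall i, measurable_fun [set: T']
     (@tnth n R ^~ i \o (fun u : T' => u : n.-tuple R)) by [].
  by move=> A mA; have := mid measurableT A mA; rewrite setTI.
apply: (measurability (@RGenOInfty.G R)) => [|/= _ [_] [r] -> <-].
  exact: RGenOInfty.measurableE.
rewrite setTI -[X in measurable X]setCK; apply: measurableC.
rewrite (_ : ~` _ = \bigcup_(k : nat)
    orthant [tuple if j == i then r else k%:R | j < n]).
  by apply: bigcup_measurable => k _; exact: mO.
apply/seteqP; split => u /=.
  rewrite in_itv/= andbT => /negP; rewrite -leNgt => ur.
  exists (\max_(j < n) (Num.truncn (tnth u j)).+1)%N => // j.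
  rewrite tnth_mktuple; case: eqP => [->//|_].
  apply/ltW/(lt_le_trans (truncnS_gt _)); rewrite ler_nat.
  exact: (leq_bigmax (F := fun j => (Num.truncn (tnth u j)).+1)).
case=> k _ /(_ i); rewrite tnth_mktuple eqxx => ur.
by rewrite in_itv/= andbT; apply/negP; rewrite -leNgt.
Qed.

(** Orthants form a pi-system, intersections being given by coordinatewise minima, and those with
    corner (k, ..., k) exhaust the space. *)
Lemma probability_orthant_unique (m1 m2 : probability (n.-tuple R) R) :
  (forall x, m1 (orthant x) = m2 (orthant x)) ->
  forall A, measurable A -> m1 A = m2 A.
Proof.
move=> m12 A mA.
apply: (@measure_unique _ _ _ (range orthant)
  (fun k : nat => orthant [tuple k%:R | i < n])) => //.
- exact: measurable_tuple_orthant.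
- move=> _ _ [x _ <-] [y _ <-].
  exists [tuple Num.min (tnth x i) (tnth y i) | i < n] => //.
  apply/seteqP; split => u /=.
    by move=> h; split=> i; have := h i; rewrite tnth_mktuple le_min => /andP[].
  by case=> hx hy i; rewrite tnth_mktuple le_min hx hy.
- apply/seteqP; split => // u _.
  exists (\max_(j < n) (Num.truncn (tnth u j)).+1)%N => // j.
  rewrite tnth_mktuple.
  apply/ltW/(lt_le_trans (truncnS_gt _)); rewrite ler_nat.
  exact: (leq_bigmax (F := fun j => (Num.truncn (tnth u j)).+1)).
- by move=> _ [x _ <-]; exact: m12.
- move=> k; rewrite (le_lt_trans (probability_le1 _ _))// ?ltry//.
  exact: measurable_orthant.
Qed.

End orthants.

HB.instance Definition _ (R : realType) (eta : probability R R) :=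
  @isMeasurableFun.Build _ _ _ _ (quantile eta) (measurable_quantile eta).

(** From right to left, x is in the set whose infimum is taken. From left to right, every [y > x] is
    in that set, and right continuity of the distribution function brings the inequality down to
    x. *)
Lemma quantile_le (R : realType) (eta : probability R R) (u x : R) :
  0 < u < 1 -> (quantile eta u <= x) = (u%:E <= eta `]-oo, x]%classic)%E.
Proof.
move=> /andP[u0 u1].
pose X : {mfun R >-> R} := HB.pack (idfun : R -> R)
  (@isMeasurableFun.Build _ _ _ _ (idfun : R -> R) (@measurable_id _ R setT)).
have cdfE y : cdf (P := eta) X y = eta `]-oo, y]%classic by [].
pose S := [set y : R | (u%:E <= eta `]-oo, y]%classic)%E].
have S0 : S !=set0.
  have /(_ _)/= h := @cvg_cdfy1 _ _ _ eta X.
  have /h [M [_ hM]] : nbhs (1%E : \bar R) [set y | (u%:E < y)%E].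
    by apply: open_nbhs_nbhs; split; [exact: open_ereal_gt_ereal|rewrite /= lte_fin].
  by exists (M + 1); apply/ltW; apply: hM; rewrite ltrDl.
have Sb : has_lbound S.
  have /(_ _)/= h := @cvg_cdfNy0 _ _ _ eta X.
  have /h [M [_ hM]] : nbhs (0%E : \bar R) [set y | (y < u%:E)%E].
    by apply: open_nbhs_nbhs; split; [exact: open_ereal_lt_ereal|rewrite /= lte_fin].
  exists M => y uy; rewrite leNgt; apply/negP => /hM/=.
  by rewrite cdfE ltNge uy.
apply/idP/idP => [qx|ux]; last exact: ge_inf.
have Sx y : x < y -> S y.
  move=> xy; have [z Sz zy] := inf_lt S0 (le_lt_trans qx xy).
  by apply: (le_trans Sz); exact: (cdf_nondecreasing X (ltW zy)).
have := @cdf_right_continuous _ _ _ eta X x => /cvg_lim cx.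
have -> : eta `]-oo, x]%classic = lim (cdf (P := eta) X r @[r --> x^'+]).
  by rewrite cx.
apply: lime_ge.
  by apply/cvg_ex; eexists; exact: cdf_right_continuous.
by near=> y; apply: Sx; near: y; exact: nbhs_right_gt.
Unshelve. all: by end_near. Qed.

(** * The measure [dC] on boxes *)

Section copula_measure.
Context (R : realType) (n : nat) (C : copula R n).

Lemma dcopula_coord (i : 'I_n) (A : set R) : measurable A ->
  dcopula C [set u | A (tnth u i)] = lebesgue_measure (A `&` `[0, 1]).
Proof. by move=> mA; rewrite -(dcopula_marginal C i mA). Qed.

Lemma dcopula_coord_null (N : 'I_n -> set R) : (forall i, measurable (N i)) ->
  (forall i, lebesgue_measure (N i `&` `[0, 1]) = 0%E) ->
  dcopula C [set u | exists i, N i (tnth u i)] = 0%E.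
Proof.
move=> mN N0.
(* The finite family is extended to nat by empty sets, so as to be treated as a countable union of
   negligible sets. *)
pose F k : set (n.-tuple R) :=
  if insub k is Some i then [set u | N i (tnth u i)] else set0.
have mNi i : measurable [set u : n.-tuple R | N i (tnth u i)].
  by rewrite -[X in measurable X]setTI; exact: (measurable_tnth i).
apply: measure_negligible; first exact: measurable_box_exists.
apply: (@negligibleS _ _ _ _ (\bigcup_k F k)).
  by move=> u [i Ni]; exists i => //; rewrite /F valK.
apply: negligible_bigcup => k; rewrite /F.
case: insubP => [i _ _|_]; last exact: negligible_set0.
apply/negligibleP => //; exact: (etrans (dcopula_coord i (mN i)) (N0 i)).
Qed.

(* On ]0, 1[, a lower set I i is ]0, a[ or ]0, a] with a its Lebesgue measure,
   so the box only differs from prod_i [0, a_i] where a coordinate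
   is 0, a_i or 1. *)
Lemma dcopula_lower_box (I : 'I_n -> set R) : (forall i, measurable (I i)) ->
  (forall i u v, 0 < u -> u <= v -> v < 1 -> I i v -> I i u) ->
  dcopula C [set u | forall i, I i (tnth u i)] =
  (C [tuple fine (lebesgue_measure (I i `&` `[0, 1])) | i < n])%:E.
Proof.
move=> mI lI; set a := [tuple _ | i < n].
have mI01 i : measurable (I i `&` `[0, 1]) by exact: measurableI.
have le1 i : (lebesgue_measure (I i `&` `[0%R, 1%R]) <= 1 :> \bar R)%E.
  have -> : 1%E = lebesgue_measure (`[0, 1]%classic : set R).
    by rewrite lebesgue_measure_itv/= lte_fin ltr01 oppr0 adde0.
  by apply: le_measure; rewrite ?inE//; exact: mI01.
have aE i : (tnth a i)%:E = lebesgue_measure (I i `&` `[0, 1]).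
  rewrite tnth_mktuple fineK// ge0_fin_numE//.
  by rewrite (le_lt_trans (le1 i))// ltry.
have a01 : unit_cube n a.
  by move=> i; rewrite -!lee_fin aE measure_ge0/=.
(* If v is not in [I i], neither is any point of ]v, 1[, so [I i] within [0, 1] lies in the union of
   [0, v] and {1}. The point 1 is added because [lI] says nothing about it. *)
have lt_a i v : 0 < v -> v < 1 -> v < tnth a i -> I i v.
  move=> v0 v1; apply: contraPP => nIv; apply/negP; rewrite -leNgt -lee_fin aE.
  have -> : v%:E = lebesgue_measure (`[0, v] `|` `[1, 1]%classic).
    rewrite measureU//=.
      rewrite !lebesgue_measure_itv/= !lte_fin v0 ltxx.
      by rewrite oppr0 !adde0.
    apply/seteqP; split => // x /=; rewrite !in_itv/=.
    move=> [/andP[_ xv] /andP[x1 _]].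
    by have := le_lt_trans (le_trans x1 xv) v1; rewrite ltxx.
  have mV : measurable (`[0, v] `|` `[1, 1]%classic : set R) by exact: measurableU.
  apply: le_measure; rewrite ?inE; [exact: mI01|exact: mV|].
  move=> x [Ix]; rewrite /= !in_itv/= => /andP[x0 x1].
  have [xv|vx] := leP x v; first by left; rewrite x0.
  have [x1'|x1'] := ltP x 1; last by right; rewrite x1.
  by exfalso; apply: nIv; apply: (lI _ _ x) => //; exact: ltW.
have gt_a i v : 0 < v -> v < 1 -> tnth a i < v -> ~ I i v.
  move=> v0 v1 + Iv; apply/negP; rewrite -leNgt -lee_fin aE.
  have -> : v%:E = lebesgue_measure `]0, v]%classic.
    by rewrite lebesgue_measure_itv/= lte_fin v0 oppr0 adde0.
  apply: le_measure; rewrite ?inE//; first exact: mI01.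
  move=> x /=; rewrite !in_itv/= => /andP[x0 xv]; split; first exact: (lI _ _ v).
  by rewrite (ltW x0) (le_trans xv (ltW v1)).
rewrite copula_funE//.
pose N i : set R := [set tnth a i] `|` ~` `]0, 1[.
have mN i : measurable (N i).
  by apply: measurableU => //; apply: measurableC; exact: measurable_itv.
apply: (measure_eq_off_null (N := [set u | exists i, N i (tnth u i)])).
- exact: measurable_box_exists.
- exact: measurable_box.
- apply: (measurable_box (I := fun i => `[0, tnth a i]%classic)) => i.
  exact: measurable_itv.
- apply: dcopula_coord_null => // i.
  apply: countable_lebesgue_measure0; apply: finite_set_countable.
  apply: (@sub_finite_set _ _ (([set tnth a i] `|` [set 0]) `|` [set 1])); last first.
    by rewrite !finite_setU; split; [split|]; exact: finite_set1.
  move=> x [[->|]]; first by do 2 left.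
  rewrite /= !in_itv/= => + /andP[]; rewrite !le_eqVlt => h.
  move=> /orP[/eqP <-|x0]; first by left; right.
  by move=> /orP[/eqP ->|x1]; [right|case: h; rewrite x0 x1].
- apply/seteqP; split => u /= [h nN]; split=> // i.
  + have : ~ N i (tnth u i) by move=> Ni; apply: nN; exists i.
    move=> /not_orP[/= ua /contrapT]; rewrite in_itv/= => /andP[u0 u1].
    rewrite (ltW u0)/= leNgt; apply/negP => au.
    exact: (gt_a i _ u0 u1 au).
  + have : ~ N i (tnth u i) by move=> Ni; apply: nN; exists i.
    move=> /not_orP[/= ua /contrapT]; rewrite in_itv/= => /andP[u0 u1].
    apply: lt_a => //; rewrite lt_neqAle; apply/andP; split; first exact/eqP.
    by have /andP[] := h i.
Qed.

End copula_measure.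

(** * Coordinatewise images of [dC] *)

Section coord_map.
Context (R : realType) (n : nat) (phi : 'I_n -> {mfun R >-> R}).

Definition coord_map (u : n.-tuple R) : n.-tuple R :=
  [tuple phi i (tnth u i) | i < n].

Lemma measurable_coord_map : measurable_fun [set: n.-tuple R] coord_map.
Proof.
apply/measurable_fun_tnthP => i.
rewrite (_ : _ \o _ = phi i \o Defs.coord i); last first.
  by apply/funext => u /=; rewrite tnth_mktuple.
by apply: measurableT_comp => //; exact: measurable_tnth.
Qed.

HB.instance Definition _ :=
  @isMeasurableFun.Build _ _ _ _ coord_map measurable_coord_map.

Lemma marginal_coord_map (P : probability (n.-tuple R) R) i (A : set R) :
  marginal (distribution P coord_map) i A = P [set u | A (phi i (tnth u i))].
Proof.
rewrite /marginal /distribution /pushforward/=; congr (P _).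
by apply/seteqP; split => u /=; rewrite /Defs.coord/= tnth_mktuple.
Qed.

Lemma coord_map_orthant (P : probability (n.-tuple R) R) x :
  distribution P coord_map (orthant x) =
  P [set u | forall i, phi i (tnth u i) <= tnth x i].
Proof.
rewrite /distribution /pushforward/=; congr (P _).
by apply/seteqP; split => u /= h i; have := h i; rewrite tnth_mktuple.
Qed.

Variable C : copula R n.

(** For nondecreasing [phi i], the sets [{phi i <= x_i}] are lower sets of ]0, 1[ whose Lebesgue
    measures are the marginal distribution functions at [x_i]; [dcopula_lower_box] is then the
    copula identity. *)
Lemma coord_map_has_copula :
  (forall i, {in `]0, 1[ &, {homo phi i : u v / u <= v}}) ->
  has_copula (distribution (dcopula C) coord_map) C.
Proof.
move=> phi_nd x; apply: (etrans (coord_map_orthant _ _)).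
have mphi i : measurable [set u | phi i u <= tnth x i].
  rewrite (_ : [set u | _] = phi i @^-1` `]-oo, tnth x i]%classic).
    by rewrite -[X in measurable X]setTI; exact: measurable_funP.
  by apply/seteqP; split => u; rewrite /= in_itv.
rewrite (dcopula_lower_box C (I := fun i => [set u | phi i u <= tnth x i]))//.
  congr (C _)%:E; apply: eq_mktuple => i; congr fine.
  apply/esym/(etrans (marginal_coord_map _ _ _)).
  by rewrite -(dcopula_coord C i).
move=> i u v u0 uv v1 /=; apply: le_trans; apply: phi_nd => //; rewrite in_itv/=.
  by rewrite u0 (le_lt_trans uv).
by rewrite v1 (lt_le_trans u0).
Qed.

(** Strict monotonicity gives [mu_i(]-oo, phi_i(u_i)]) = u_i] for every u in the cube. Every point
    of the cube is thus a tuple of marginal distribution values, and the copula identity determines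
    the copula there. *)
Lemma coord_map_unique_copula :
  (forall i, {in `[0, 1] &, {homo phi i : u v / u < v}}) ->
  has_unique_copula (distribution (dcopula C) coord_map) C.
Proof.
move=> phi_lt.
have mono i : {in `[0, 1] &, {mono phi i : u v / u <= v}}.
  exact/le_mono_in/phi_lt.
have hC : has_copula (distribution (dcopula C) coord_map) C.
  apply: coord_map_has_copula => i u v u01 v01; rewrite mono//.
    by move: u01; apply: subset_itvW.
  by move: v01; apply: subset_itvW.
split => // C' hC' u; rewrite inE => u01.
have [] := etrans (esym (hC' (coord_map u))) (hC (coord_map u)).
rewrite (_ : [tuple _ | i < n] = u)//; apply: eq_from_tnth => i.
rewrite tnth_mktuple.
suff mE : marginal (distribution (dcopula C) coord_map) i
    `]-oo, tnth (coord_map u) i]%classic = (tnth u i)%:E by exact: (congr1 fine mE).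
apply: (etrans (marginal_coord_map _ _ _)).
apply: (etrans (dcopula_coord C i
  (A := [set v | phi i v \in `]-oo, tnth (coord_map u) i]]) _)).
  rewrite (_ : [set u | _] = phi i @^-1` `]-oo, tnth (coord_map u) i]%classic)//.
  by rewrite -[X in measurable X]setTI; exact: measurable_funP.
have -> : [set v | phi i v \in `]-oo, tnth (coord_map u) i]] `&` `[0, 1] =
    `[0, tnth u i]%classic.
  have ui : tnth u i \in `[0, 1] by rewrite in_itv/=; exact: u01.
  apply/seteqP; split => v /=; rewrite !in_itv/= tnth_mktuple.
    move=> [+ v01]; rewrite mono ?in_itv// => ->.
    by case/andP: v01 => ->.
  move=> /andP[v0 vu]; have v01 : 0 <= v <= 1.
    by rewrite v0 (le_trans vu)//; have /andP[] := u01 i.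
  by rewrite mono ?in_itv.
rewrite lebesgue_measure_itv/= lte_fin oppr0 adde0.
case: ltgtP => //= [|<-//]; have /andP[+ _] := u01 i.
by case: ltgtP.
Qed.

End coord_map.

(** * Quantile maps and the diamond coupling *)

Section quantile_transform.
Context (R : realType) (n : nat) (C : copula R n).

Definition quantile_map (mu : probability (n.-tuple R) R) (i : 'I_n) : {mfun R >-> R} :=
  quantile (marginal mu i).

(** It is enough to compare orthants. By [quantile_le], the lower set [{Q_i <= x_i}] has measure
    [F_i(x_i)], so both sides equal [C] at the tuple of the [F_i(x_i)]. *)
Lemma coord_map_quantile (mu : probability (n.-tuple R) R) : has_copula mu C ->
  forall A, measurable A ->
  distribution (dcopula C) (coord_map (quantile_map mu)) A = mu A.
Proof.
move=> muC; apply: probability_orthant_unique => x.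
apply: (etrans (coord_map_orthant _ _ _)); apply/esym/(etrans (muC x)).
have mQ i : measurable [set u | quantile_map mu i u <= tnth x i].
  rewrite (_ : [set u | _] = quantile_map mu i @^-1` `]-oo, tnth x i]%classic).
    by rewrite -[X in measurable X]setTI; exact: measurable_funP.
  by apply/seteqP; split => u; rewrite /= in_itv.
apply/esym/(etrans (dcopula_lower_box C
  (I := fun i => [set u | quantile_map mu i u <= tnth x i]) mQ _)).
  move=> i u v u0 uv v1 /=; apply: le_trans.
  apply: quantile_homo => //; rewrite in_itv/=.
    by rewrite u0 (le_lt_trans uv).
  by rewrite v1 (lt_le_trans u0).
congr (C _)%:E; apply: eq_mktuple => i; congr fine.
set F := marginal mu i _.
have F01 : (0%E <= F <= 1%E)%E by rewrite measure_ge0 probability_le1.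
have Ffin : F \is a fin_num.
  by case/andP: F01 => F0 F1; rewrite ge0_fin_numE// (le_lt_trans F1)// ltry.
have -> : F = lebesgue_measure (`[0, fine F]%classic : set R).
  rewrite lebesgue_measure_itv/= lte_fin oppr0 adde0 fineK//.
  have : 0 <= fine F by apply: fine_ge0; case/andP: F01.
  rewrite le_eqVlt => /orP[/eqP F0|->//]; rewrite -F0 ltxx.
  by rewrite -(fineK Ffin) -F0.
have m01 : measurable ([set 0] `|` [set 1] : set R) by exact: measurableU.
have mQ01 : measurable ([set u | quantile_map mu i u <= tnth x i] `&` `[0, 1]).
  exact: measurableI.
(* The endpoints 0 and 1 are removed because [quantile_le] only holds on ]0, 1[. *)
apply: (@measure_eq_off_null _ _ _ (@lebesgue_measure R) ([set 0] `|` [set 1])) => /=.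
- exact: m01.
- exact: mQ01.
- exact: measurable_itv.
- apply: countable_lebesgue_measure0; apply: finite_set_countable.
  by rewrite finite_setU; split; exact: finite_set1.
- apply/seteqP; split => u /=; rewrite !in_itv/=.
    move=> [[Qu /andP[u0 u1]] /not_orP[/eqP n0 /eqP n1]].
    split; last by apply/not_orP; split; exact/eqP.
    rewrite u0/= -lee_fin fineK// -quantile_le//.
    by rewrite !lt_neqAle eq_sym n0 n1 u0.
  move=> [/andP[u0 uF] /not_orP[/eqP n0 /eqP n1]].
  have u1 : u <= 1.
    by rewrite (le_trans uF)// -lee_fin fineK//; case/andP: F01.
  split; last by apply/not_orP; split; exact/eqP.
  rewrite u0 u1; split => //; rewrite quantile_le; last first.
    by rewrite !lt_neqAle eq_sym n0 n1 u0.
  by apply: (@le_trans _ _ (fine F)%:E); rewrite ?lee_fin// fineK.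
Qed.

Lemma quantile_law (mu : probability (n.-tuple R) R) : has_copula mu C ->
  forall i A, measurable A ->
  dcopula C [set u | A (quantile_map mu i (tnth u i))] = marginal mu i A.
Proof.
move=> muC i A mA; rewrite -marginal_coord_map; apply: coord_map_quantile => //.
by rewrite -[X in measurable X]setTI; exact: measurable_tnth.
Qed.

(** Each component of [quantile_pair] is a coordinatewise quantile map, which sends [dC] to the
    corresponding measure. *)
Lemma diamond_coupling (mu rho : probability (n.-tuple R) R) :
  has_copula mu C -> has_copula rho C -> is_coupling mu rho (diamond mu rho C).
Proof.
move=> muC rhoC A mA; split.
  by rewrite -(coord_map_quantile muC mA).
by rewrite -(coord_map_quantile rhoC mA).
Qed.

(** A strictly increasing, left continuous function is the quantile function of its own law; the
    second hypothesis is left continuity. If the quantile q at u were below [phi i u], some v < u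
    would have [q < phi i v], and [{phi i <= q}] would have measure at most v, against
    [quantile_le]. *)
Lemma quantile_coord_map (phi : 'I_n -> {mfun R >-> R}) i :
  {in `[0, 1] &, {homo phi i : u v / u < v}} ->
  (forall u x, 0 < u < 1 -> x < phi i u -> exists2 v, 0 < v < u & x < phi i v) ->
  {in `]0, 1[, quantile_map (distribution (dcopula C) (coord_map phi)) i =1 phi i}.
Proof.
move=> phi_lt phi_lc u; rewrite in_itv/= => u01.
have mono : {in `[0, 1] &, {mono phi i : u v / u <= v}}.
  exact/le_mono_in/phi_lt.
pose D x := [set v | phi i v \in `]-oo, x]].
have mD x : measurable (D x).
  rewrite (_ : D x = phi i @^-1` `]-oo, x]%classic)//.
  by rewrite -[X in measurable X]setTI; exact: measurable_funP.
have cdfE x : marginal (distribution (dcopula C) (coord_map phi)) i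
    `]-oo, x]%classic = lebesgue_measure (D x `&` `[0, 1]).
  apply: (etrans (marginal_coord_map _ _ _ _)).
  exact: (etrans _ (dcopula_coord C i (mD x))).
have itvE v : 0 < v -> v%:E = lebesgue_measure (`[0, v]%classic : set R).
  by move=> v0; rewrite lebesgue_measure_itv/= lte_fin v0 oppr0 adde0.
have qE x : (quantile_map (distribution (dcopula C) (coord_map phi)) i u <= x) =
    (u%:E <= lebesgue_measure (D x `&` `[0%R, 1%R]))%E.
  by rewrite -cdfE; exact: quantile_le.
have mDI x : measurable (D x `&` `[0, 1]) by exact: measurableI.
case/andP: (u01) => u0 u1.
apply/eqP; rewrite eq_le; apply/andP; split.
  rewrite qE (itvE u)//; apply: le_measure; rewrite ?inE//; first exact: mDI.
  move=> v /=; rewrite in_itv/= => /andP[v0 vu].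
  have v1 := le_trans vu (ltW u1).
  by rewrite /D/= !in_itv/= v0 v1 mono// in_itv/= ?v0 ?v1// !ltW.
rewrite leNgt; apply/negP => /(phi_lc _ _ u01) [v /andP[v0 vu] qv].
have := lexx (quantile_map (distribution (dcopula C) (coord_map phi)) i u).
rewrite qE => /le_lt_trans.
suff : (lebesgue_measure (D (quantile_map
    (distribution (dcopula C) (coord_map phi)) i u) `&` `[0%R, 1%R]) < u%:E)%E.
  by move=> h /(_ _ h); rewrite ltxx.
rewrite (@le_lt_trans _ _ v%:E)// ?lte_fin// (itvE v)//.
apply: le_measure; rewrite ?inE//; first exact: mDI.
move=> w [/=]; rewrite /D/= !in_itv/= => Dw /andP[w0 w1]; rewrite w0/=.
rewrite leNgt; apply/negP => vw; have := le_lt_trans Dw qv.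
by rewrite ltNge mono ?(ltW vw)// in_itv/= ?w0 ?w1// ltW//= (le_trans (ltW vu))// ltW.
Qed.

End quantile_transform.

(** * One-dimensional monotone transport *)

Section positive_part_power.
Context (R : realType).
Implicit Types a p t x y : R.

(** Taking the positive part makes the power monotone and continuous on the whole line for a > 0.
    [ppow 0] is the constant 1, the value needed for the exponent p - 1 when p = 1. *)
Definition ppow a t : R := (Num.max t 0) `^ a.

Lemma ppow_ge0 a t : 0 <= ppow a t. Proof. exact: powR_ge0. Qed.

Lemma ppow_pos a t : 0 <= t -> ppow a t = t `^ a.
Proof. by move=> t0; rewrite /ppow max_l. Qed.

Lemma le_ppow a : 0 <= a -> {homo ppow a : s t / s <= t}.
Proof.
move=> a0 s t st; apply: ge0_ler_powR => //.
- by rewrite nnegrE le_max lexx orbT.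
- by rewrite nnegrE le_max lexx orbT.
- by rewrite ge_max !le_max st lexx orbT.
Qed.

Lemma measurable_ppow a : measurable_fun [set: R] (ppow a).
Proof.
apply: (measurableT_comp (measurable_powR _)).
exact: measurable_maxr.
Qed.

Lemma continuous_ppow a : 0 < a -> continuous (ppow a).
Proof.
move=> a0 t; have [t0|t0|->] := ltgtP t 0.
- rewrite /continuous_at /ppow (max_r (ltW t0)).
  apply: cvg_near_cst; near=> s; rewrite max_r//.
  by apply/ltW; near: s; exact: lt_nbhsl.
- rewrite /continuous_at ppow_pos ?ltW//.
  have : {for t, continuous (fun s : R => s `^ a)}.
    apply/differentiable_continuous/derivable1_diffP.
    by apply: derivable_powR; rewrite in_itv/= t0.
  apply: cvg_trans; apply: near_eq_cvg; near=> s; rewrite ppow_pos//.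
  by apply/ltW; near: s; exact: lt_nbhsr.
- rewrite /continuous_at ppow_pos// powR0 ?gt_eqF//.
  apply/cvgrPdist_lt => e e0; near=> s.
  rewrite sub0r normrN ger0_norm ?ppow_ge0//.
  (* The radius of the neighbourhood of 0 is e to the power 1/a. *)
  have -> : e = (e `^ a^-1) `^ a by rewrite -powRrM mulVf ?gt_eqF// powRr1// ltW.
  apply: gt0_ltr_powR; rewrite ?nnegrE ?le_max ?lexx ?orbT ?powR_ge0//.
  rewrite gt_max powR_gt0// andbT.
  by near: s; apply: lt_nbhsl; rewrite powR_gt0.
Unshelve. all: by end_near. Qed.

Lemma continuous_ppow_pred p : 1 <= p -> continuous (ppow (p - 1)).
Proof.
rewrite le_eqVlt => /orP[/eqP<- x|p1]; last first.
  by apply: continuous_ppow; rewrite subr_gt0.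
rewrite subrr /continuous_at /ppow powRr0.
by under eq_fun do rewrite powRr0; exact: cvg_cst.
Qed.

(** Fundamental theorem of calculus with primitive [F s = - ppow p (y - s)], which agrees with a
    plain power near each s < y. *)
Lemma integral_ppow p x y : 1 <= p -> x <= y ->
  (\int[lebesgue_measure]_(s in `[x, y]) (p * ppow (p - 1) (y - s))%:E =
   ((y - x) `^ p)%:E)%E.
Proof.
move=> p1; have p0 : 0 < p by rewrite (lt_le_trans ltr01).
rewrite le_eqVlt => /orP[/eqP <-|xy].
  by rewrite set_itv1 integral_set1 subrr powR0 ?gt_eqF.
pose F s := - ppow p (y - s).
have cB : continuous (fun s : R => y - s).
  by move=> s; apply: cvgB; [exact: cvg_cst|exact: cvg_id].
have cF : continuous F.
  move=> s; apply: cvgN; apply: (@continuous_comp _ _ _ (fun s => y - s) (ppow p)).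
    exact: cB.
  exact: continuous_ppow.
have dF s : x < s < y -> is_derive s 1 F (p * ppow (p - 1) (y - s)).
  move=> /andP[xs sy].
  apply: (@near_eq_is_derive _ _ _ (fun s => - ((y - s) `^ p))).
    near=> r; rewrite /F ppow_pos// subr_ge0.
    by apply/ltW; near: r; exact: lt_nbhsl.
  have ys : 0 < y - s by rewrite subr_gt0.
  have d1 : is_derive s 1 (fun s : R => y - s) (- 1).
    rewrite -[X in is_derive _ _ _ X]add0r.
    by apply: is_deriveB.
  have d2 := is_derive1_powR p ys.
  have d3 := @is_derive1_comp _ (fun t : R => t `^ p) (fun s : R => y - s) s _ _ d2 d1.
  have -> : p * ppow (p - 1) (y - s) = - (p * (y - s) `^ (p - 1) * - 1).
    by rewrite ppow_pos ?ltW// mulrN1 opprK.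
  exact: is_deriveN.
rewrite (@continuous_FTC2 _ _ F)//.
- rewrite /F subrr ppow_pos// powR0 ?gt_eqF// oppr0 ppow_pos ?subr_ge0 ?ltW//.
  by rewrite EFinN oppeK add0e.
- apply: continuous_subspaceT => s; apply: cvgM; first exact: cvg_cst.
  apply: (@continuous_comp _ _ _ (fun s => y - s) (ppow (p - 1))).
    exact: cB.
  exact: continuous_ppow_pred.
- split; [|exact/cvg_at_right_filter/cF|exact/cvg_at_left_filter/cF].
  by move=> s; rewrite in_itv/= => /dF[].
- by move=> s; rewrite in_itv/= => /dF[]; rewrite derive1E.
Unshelve. all: by end_near. Qed.

End positive_part_power.

(** * The cost as an integral of indicator kernels *)

Section transport_kernel.
Context (R : realType).
Implicit Types p x y s r : R.

Definition transport_kernel p x y s : R :=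
  if (x <= s) && (s <= y) then p * ppow (p - 1) (y - s) else 0.

Lemma transport_kernel_ge0 p x y s : 0 <= p -> 0 <= transport_kernel p x y s.
Proof.
by move=> p0; rewrite /transport_kernel; case: ifP => // _; rewrite mulr_ge0// ppow_ge0.
Qed.

Lemma measurable_transport_kernel d (T : measurableType d) p (X Y Z : T -> R) :
  measurable_fun setT X -> measurable_fun setT Y -> measurable_fun setT Z ->
  measurable_fun setT (fun t => transport_kernel p (X t) (Y t) (Z t)).
Proof.
move=> mX mY mZ; apply: measurable_fun_ifT.
- by apply: measurable_and; exact: measurable_fun_ler.
- apply: measurable_funM => //.
  apply: (measurableT_comp (measurable_ppow _)).
  exact: measurable_funB.
- exact: measurable_cst.
Qed.

Lemma integral_transport_kernel p x y : 1 <= p ->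
  (\int[lebesgue_measure]_s (transport_kernel p x y s)%:E =
   (if (x <= y)%R then (y - x) `^ p else 0)%:E)%E.
Proof.
move=> p1; have [xy|yx] := leP x y.
  rewrite -integral_ppow// [RHS]integral_mkcond; apply: eq_integral => s _.
  rewrite patchE /transport_kernel; case: ifPn => [h|h]; case: ifPn => //.
    by rewrite notin_setE/= in_itv/= h.
  by rewrite inE/= in_itv/= (negbTE h).
rewrite integral0_eq// => s _; rewrite /transport_kernel; case: ifPn => //.
by move=> /andP[xs sy]; have := lt_le_trans yx (le_trans xs sy); rewrite ltxx.
Qed.

(** When x and y differ, only the kernel whose arguments are in increasing order contributes; when
    they are equal, everything vanishes since p > 0. *)
Lemma powR_norm_sub_kernel p x y : 1 <= p ->
  ((`|x - y| `^ p)%:E = \int[lebesgue_measure]_s (transport_kernel p x y s)%:E +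
                        \int[lebesgue_measure]_s (transport_kernel p y x s)%:E)%E.
Proof.
move=> p1; rewrite !integral_transport_kernel//.
have [xy|yx|->] := ltgtP x y.
- by rewrite adde0 distrC gtr0_norm// subr_gt0.
- by rewrite add0e gtr0_norm// subr_gt0.
- by rewrite subrr normr0 powR0 ?adde0// gt_eqF// (lt_le_trans ltr01).
Qed.

Definition upper_set (U : set R) := forall x y, U x -> x <= y -> U y.

(* Layer cake: for fixed s and r >= 0, {kernel > r} is an event of the form
   {X <= s, Y in U} with U an upper set. *)
Lemma le_integral_transport_kernel d1 d2 (T1 : measurableType d1)
    (T2 : measurableType d2) (P1 : probability T1 R) (P2 : probability T2 R)
    (X1 Y1 : {mfun T1 >-> R}) (X2 Y2 : {mfun T2 >-> R}) p : 1 <= p ->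
  (forall s U, measurable U -> upper_set U ->
    (P1 [set t | (X1 t <= s)%R /\ U (Y1 t)] <=
     P2 [set t | (X2 t <= s)%R /\ U (Y2 t)])%E) ->
  (\int[P1]_t \int[lebesgue_measure]_s (transport_kernel p (X1 t) (Y1 t) s)%:E <=
   \int[P2]_t \int[lebesgue_measure]_s (transport_kernel p (X2 t) (Y2 t) s)%:E)%E.
Proof.
move=> p1 P12; have p0 : 0 <= p by rewrite (le_trans ler01).
have mk d (T : measurableType d) (X Y : {mfun T >-> R}) :
    measurable_fun setT (fun z : T * R => (transport_kernel p (X z.1) (Y z.1) z.2)%:E).
  apply/measurable_EFinP; apply: measurable_transport_kernel => //.
    exact: (measurableT_comp (measurable_funP X)).
  exact: (measurableT_comp (measurable_funP Y)).
have k0 d (T : measurableType d) (X Y : {mfun T >-> R}) (z : T * R) :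
    (0%R <= (transport_kernel p (X z.1) (Y z.1) z.2)%:E)%E.
  by rewrite lee_fin transport_kernel_ge0.
(* Tonelli moves the integral in s outside, which reduces the comparison to a fixed s. *)
have FT d (T : measurableType d) (P : probability T R) (X Y : {mfun T >-> R}) :
    (\int[P]_t \int[lebesgue_measure]_s (transport_kernel p (X t) (Y t) s)%:E =
     \int[lebesgue_measure]_s \int[P]_t (transport_kernel p (X t) (Y t) s)%:E)%E.
  exact: (fubini_tonelli (m1 := P) (m2 := @lebesgue_measure R) _
    (mk _ _ X Y) (k0 _ _ X Y)).
rewrite !FT; apply: ge0_le_integral => //=.
- by move=> s _; apply: integral_ge0 => t _; rewrite lee_fin transport_kernel_ge0.
- exact: (measurable_fun_fubini_tonelli_G (m1 := P1) _ (mk _ _ X1 Y1) (k0 _ _ X1 Y1)).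
- exact: (measurable_fun_fubini_tonelli_G (m1 := P2) _ (mk _ _ X2 Y2) (k0 _ _ X2 Y2)).
move=> s _.
have mks d (T : measurableType d) (X Y : {mfun T >-> R}) :
    measurable_fun setT (fun t : T => transport_kernel p (X t) (Y t) s).
  exact: measurable_transport_kernel.
pose K1 : {mfun T1 >-> R} := HB.pack (fun t => transport_kernel p (X1 t) (Y1 t) s)
  (@isMeasurableFun.Build _ _ _ _ _ (mks _ _ X1 Y1)).
pose K2 : {mfun T2 >-> R} := HB.pack (fun t => transport_kernel p (X2 t) (Y2 t) s)
  (@isMeasurableFun.Build _ _ _ _ _ (mks _ _ X2 Y2)).
have K10 t : 0 <= K1 t by exact: transport_kernel_ge0.
have K20 t : 0 <= K2 t by exact: transport_kernel_ge0.
(* The expectation of a nonnegative variable is the integral of its tail probabilities over r >=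
   0. *)
have := @ge0_expectation_ccdf _ _ _ P1 K1 K10; rewrite expectation_def => ->.
have := @ge0_expectation_ccdf _ _ _ P2 K2 K20; rewrite expectation_def => ->.
have mK1 : measurable_fun `[(0 : R), +oo[ (ccdf (P := P1) K1).
  by apply: measurable_funTS; exact: ccdf_measurable.
have mK2 : measurable_fun `[(0 : R), +oo[ (ccdf (P := P2) K2).
  by apply: measurable_funTS; exact: ccdf_measurable.
apply: ge0_le_integral => //.
move=> r; rewrite /= in_itv/= andbT => r0.
(* On [{X <= s}], the kernel exceeds r exactly when Y is in U. As r >= 0, the value 0 of the kernel
   outside its support never exceeds r. *)
pose U := [set y | s <= y /\ r < p * ppow (p - 1) (y - s)].
have mU : measurable U.
  rewrite (_ : U = `[s, +oo[ `&`
      (fun y => p * ppow (p - 1) (y - s)) @^-1` `]r, +oo[).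
    apply: measurableI => //; rewrite -[X in measurable X]setTI.
    apply: (_ : measurable_fun _ _) => //; apply: measurable_funM => //.
    by apply: (measurableT_comp (measurable_ppow _)); exact: measurable_funB.
  by apply/seteqP; split => y /=; rewrite !in_itv/= !andbT.
have uU : upper_set U.
  move=> x y [sx rx] xy; split; first exact: le_trans xy.
  apply: (lt_le_trans rx); rewrite ler_wpM2l//; apply: le_ppow.
    by rewrite subr_ge0.
  by rewrite lerB.
have ccdfE d (T : measurableType d) (X Y : {mfun T >-> R}) t :
    (r < transport_kernel p (X t) (Y t) s) <-> (X t <= s /\ U (Y t)).
  rewrite /transport_kernel; case: ifPn => [/andP[Xs sY]|h].
    by split=> [rk|[_ []]//]; split.
  split; first by rewrite ltNge r0.
  by move=> [Xs [sY _]]; rewrite Xs sY in h.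
have -> : ccdf (P := P1) K1 r = P1 [set t | X1 t <= s /\ U (Y1 t)].
  rewrite /ccdf /distribution /pushforward; congr (P1 _).
  by apply/seteqP; split => t; rewrite /= in_itv/= andbT => /ccdfE.
have -> : ccdf (P := P2) K2 r = P2 [set t | X2 t <= s /\ U (Y2 t)].
  rewrite /ccdf /distribution /pushforward; congr (P2 _).
  by apply/seteqP; split => t; rewrite /= in_itv/= andbT => /ccdfE.
exact: P12.
Qed.

End transport_kernel.

(** * Minimality of the monotone coupling *)

Section monotone_rearrangement.
Context (R : realType) (P : probability R R).
Hypothesis P01 : P (~` `]0, 1[) = 0%E.
Context d (T : measurableType d) (Q : probability T R).

(* The events {f <= s} and {g notin U} are nested up to a null set, so the left
   hand side is the Frechet lower bound (P(f <= s) - P(g notin U))^+. *)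
Lemma comonotone_le (f g : {mfun R >-> R}) (X Y : {mfun T >-> R}) :
  {in `]0, 1[ &, {homo f : u v / u <= v}} ->
  {in `]0, 1[ &, {homo g : u v / u <= v}} ->
  (forall A, measurable A -> Q (X @^-1` A) = P (f @^-1` A)) ->
  (forall A, measurable A -> Q (Y @^-1` A) = P (g @^-1` A)) ->
  forall s U, measurable U -> upper_set U ->
  (P [set t | (f t <= s)%R /\ U (g t)] <= Q [set t | (X t <= s)%R /\ U (Y t)])%E.
Proof.
move=> f_nd g_nd Xf Yg s U mU uU.
have mpre d' (T' : measurableType d') (h : {mfun T' >-> R}) A :
    measurable A -> measurable (h @^-1` A).
  by move=> mA; rewrite -[X in measurable X]setTI; exact: measurable_funP.
have mUC : measurable (~` U) by exact: measurableC.
have ms : measurable (`]-oo, s]%classic : set R) by exact: measurable_itv.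
have E1 d' (T' : measurableType d') (h k : {mfun T' >-> R}) :
    [set t | h t <= s /\ U (k t)] = h @^-1` `]-oo, s] `\` k @^-1` (~` U).
  apply/seteqP; split => t /=; rewrite in_itv/=; first by case; split.
  by case=> ? /contrapT; split.
(* First case: on ]0, 1[ the event [{f <= s}] lies in [{g notin U}], so the left-hand side is 0. *)
have [nest|] := pselect (forall u, 0 < u < 1 -> f u <= s -> ~ U (g u)).
  apply: (@le_trans _ _ 0%E) => //; rewrite -P01; apply: le_measure; rewrite ?inE.
  - by rewrite E1; apply: measurableD; exact: mpre.
  - by apply: measurableC; exact: measurable_itv.
  - by move=> u [fs Ug] /=; rewrite in_itv/= => /nest /(_ fs).
(* Second case: some u has [f u <= s] and [g u] in U. A w with [g w] outside U cannot exceed u, so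
   [{g notin U}] lies in [{f <= s}]. The difference of probabilities is then attained under P, while
   it is only a lower bound under Q. *)
move=> /existsNP[u /not_implyP[u01 /not_implyP[fs /contrapT Ug]]].
have nest w : 0 < w < 1 -> ~ U (g w) -> f w <= s.
  move=> w01 nUg; apply: le_trans fs; apply: f_nd; rewrite ?in_itv//=.
  rewrite leNgt; apply/negP => uw; apply: nUg; apply: uU Ug _.
  by apply: g_nd; rewrite ?in_itv//= ltW.
have fin d' (T' : measurableType d') (P' : probability T' R) A :
    measurable A -> P' A \is a fin_num by move=> mA; exact: fin_num_measure.
have PE : (P (f @^-1` `]-oo, s]) =
    P [set t | (f t <= s)%R /\ U (g t)] + P (g @^-1` (~` U)))%E.
  rewrite E1 (measureDI P (mpre _ _ f _ ms) (mpre _ _ g _ mUC)); congr (_ + _)%E.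
  apply: (@measure_eq_off_null _ _ _ P (~` `]0, 1[)) => //.
  - by apply: measurableC; exact: measurable_itv.
  - by apply: measurableI; exact: mpre.
  - exact: mpre.
  - apply/seteqP; split => w [] /=; first by move=> [_ nU] h; split.
    move=> nU /contrapT h; split => //.
    split => //; rewrite /= in_itv/=; exact: nest.
have QE : (Q (X @^-1` `]-oo, s]) <=
    Q [set t | (X t <= s)%R /\ U (Y t)] + Q (Y @^-1` (~` U)))%E.
  rewrite E1 (measureDI Q (mpre _ _ X _ ms) (mpre _ _ Y _ mUC)) leeD2l//.
  apply: le_measure; rewrite ?inE; [|exact: mpre|exact: subIsetr].
  by apply: measurableI; exact: mpre.
have := QE; rewrite Xf// PE Yg// leeD2rE//; exact/fin/mpre.
Qed.

(** The cost splits into a kernel in (X, Y) and one in (Y, X), and [comonotone_le] applies to both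
    because its hypotheses are symmetric in f and g. *)
Lemma monotone_transport_le (f g : {mfun R >-> R}) (X Y : {mfun T >-> R}) p :
  1 <= p ->
  {in `]0, 1[ &, {homo f : u v / u <= v}} ->
  {in `]0, 1[ &, {homo g : u v / u <= v}} ->
  (forall A, measurable A -> Q (X @^-1` A) = P (f @^-1` A)) ->
  (forall A, measurable A -> Q (Y @^-1` A) = P (g @^-1` A)) ->
  (\int[P]_u (`|f u - g u| `^ p)%:E <= \int[Q]_t (`|X t - Y t| `^ p)%:E)%E.
Proof.
move=> p1 f_nd g_nd Xf Yg.
have p0 : 0 <= p by rewrite (le_trans ler01).
have IE d' (T' : measurableType d') (P' : probability T' R) (h k : {mfun T' >-> R}) :
    (\int[P']_t (`|h t - k t| `^ p)%:E =
     \int[P']_t \int[lebesgue_measure]_s (transport_kernel p (h t) (k t) s)%:E +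
     \int[P']_t \int[lebesgue_measure]_s (transport_kernel p (k t) (h t) s)%:E)%E.
  under eq_integral do rewrite powR_norm_sub_kernel//.
  have k0 x y : (0%R <= \int[lebesgue_measure]_s (transport_kernel p x y s)%:E)%E.
    by apply: integral_ge0 => s _; rewrite lee_fin transport_kernel_ge0.
  have mI (h' k' : {mfun T' >-> R}) : measurable_fun setT (fun t : T' =>
      (\int[lebesgue_measure]_s (transport_kernel p (h' t) (k' t) s)%:E)%E).
    under eq_fun do rewrite integral_transport_kernel//.
    apply/measurable_EFinP; apply: measurable_fun_ifT => //.
      exact: measurable_fun_ler.
    by apply: (measurableT_comp (measurable_powR _)); exact: measurable_funB.
  by rewrite ge0_integralD//; exact: mI.
rewrite !IE; apply: leeD; apply: le_integral_transport_kernel => //.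
  exact: comonotone_le.
exact: comonotone_le.
Qed.

End monotone_rearrangement.

(** * The case p = q *)

Lemma ge0_integral_sumEFin d (T : measurableType d) (R : realType)
    (m : {measure set T -> \bar R}) (D : set T) n (f : 'I_n -> T -> R) :
  measurable D -> (forall i, measurable_fun setT (f i)) -> (forall i t, 0 <= f i t) ->
  (\int[m]_(t in D) (\sum_(i < n) f i t)%:E =
   \sum_(i < n) \int[m]_(t in D) (f i t)%:E)%E.
Proof.
move=> mD mf f0; rewrite -ge0_integral_sum//.
- by apply: eq_integral => t _; rewrite sumEFin.
- by move=> i; apply/measurable_EFinP; exact: measurable_funTS.
- by move=> i t _; rewrite lee_fin.
Qed.

(** * The transport integral and its coordinates *)

Section transport_cost.
Context (R : realType) (n : nat).

Definition cdiff (z : n.-tuple R * n.-tuple R) : n.-tuple R :=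
  [tuple tnth z.1 i - tnth z.2 i | i < n].

Lemma measurable_cdiff_tnth i :
  measurable_fun setT (fun z : n.-tuple R * n.-tuple R => tnth (cdiff z) i).
Proof.
under eq_fun do rewrite tnth_mktuple.
apply: measurable_funB.
  exact: (measurableT_comp (measurable_tnth i) measurable_fst).
exact: (measurableT_comp (measurable_tnth i) measurable_snd).
Qed.

Lemma lnorm_powR p q (x : n.-tuple R) :
  lnorm q x `^ p = (\sum_(i < n) `|tnth x i| `^ q) `^ (p / q).
Proof. by rewrite /lnorm -powRrM mulrC. Qed.

Lemma measurable_lnorm_cdiff p q :
  measurable_fun setT (fun z : n.-tuple R * n.-tuple R => lnorm q (cdiff z) `^ p).
Proof.
apply: (measurableT_comp (measurable_powR p)).
apply: (measurableT_comp (measurable_powR q^-1)).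
apply: measurable_sum => i; apply: (measurableT_comp (measurable_powR q)).
exact: (measurableT_comp (@normr_measurable _ _) (measurable_cdiff_tnth i)).
Qed.

(** The p-th power of [transport_cost], which is additive and easier to estimate; the root is taken
    only at the end. *)
Definition transport_integral p q (nu : probability (n.-tuple R * n.-tuple R)%type R) :=
  (\int[nu]_z (lnorm q (cdiff z) `^ p)%:E)%E.

Lemma transport_costE p q nu :
  transport_cost p q nu = (transport_integral p q nu `^ p^-1)%E.
Proof. by []. Qed.

Lemma transport_integral_ge0 p q nu : (0 <= transport_integral p q nu)%E.
Proof. by apply: integral_ge0 => z _; rewrite lee_fin powR_ge0. Qed.

Lemma transport_integral_sum p nu : 0 < p ->
  (transport_integral p p nu =
   \sum_(i < n) \int[nu]_z (`|tnth z.1 i - tnth z.2 i| `^ p)%:E)%E.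
Proof.
move=> p0; rewrite -ge0_integral_sumEFin//; last first.
  move=> i; apply: (measurableT_comp (measurable_powR p)).
  apply: (measurableT_comp (@normr_measurable _ _)).
  by have := @measurable_cdiff_tnth i; under eq_fun do rewrite tnth_mktuple.
apply: eq_integral => z _.
rewrite lnorm_powR divff ?gt_eqF// powRr1; last first.
  by apply: sumr_ge0 => i _; exact: powR_ge0.
by congr (_%:E); apply: eq_bigr => i _; rewrite tnth_mktuple.
Qed.

Definition fst_coord (i : 'I_n) (z : n.-tuple R * n.-tuple R) : R := tnth z.1 i.
Definition snd_coord (i : 'I_n) (z : n.-tuple R * n.-tuple R) : R := tnth z.2 i.

HB.instance Definition _ i := @isMeasurableFun.Build _ _ _ _ (fst_coord i)
  (measurableT_comp (measurable_tnth i) measurable_fst).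
HB.instance Definition _ i := @isMeasurableFun.Build _ _ _ _ (snd_coord i)
  (measurableT_comp (measurable_tnth i) measurable_snd).

End transport_cost.

(** * Optimality of the diamond coupling *)

Section optimality.
Context (R : realType) (n : nat) (C : copula R n).
Variables (mu rho : probability (n.-tuple R) R).
Hypotheses (muC : has_copula mu C) (rhoC : has_copula rho C).

Lemma dcopula_marginal_oo i : marginal (dcopula C) i (~` `]0, 1[) = 0%E.
Proof.
rewrite dcopula_marginal; last by apply: measurableC; exact: measurable_itv.
apply: countable_lebesgue_measure0; apply: finite_set_countable.
apply: (@sub_finite_set _ _ ([set 0] `|` [set 1])); last first.
  by rewrite finite_setU; split; exact: finite_set1.
move=> x /=; rewrite !in_itv/= => -[+ /andP[]]; rewrite !le_eqVlt => h.
move=> /orP[/eqP <-|x0]; first by left.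
by move=> /orP[/eqP ->|x1]; [right|case: h; rewrite x0 x1].
Qed.

Lemma integral_dcopula_marginal (f : R -> R) i : measurable_fun setT f ->
  (forall u, 0 <= f u) ->
  (\int[marginal (dcopula C) i]_u (f u)%:E = \int[dcopula C]_u (f (tnth u i))%:E)%E.
Proof.
by move=> mf f0; rewrite ge0_integral_distribution//; exact/measurable_EFinP.
Qed.

Let measurable_cost (f g : {mfun R >-> R}) (p : R) :
  measurable_fun setT (fun u : R => `|f u - g u| `^ p).
Proof.
apply: (measurableT_comp (measurable_powR p)).
by apply: (measurableT_comp (@normr_measurable _ _)); exact: measurable_funB.
Qed.

(** Under the diamond, the i-th coordinates of both points are functions of [u_i] alone. *)
Lemma integral_diamond_coord p i :
  (\int[diamond mu rho C]_z (`|tnth z.1 i - tnth z.2 i| `^ p)%:E =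
   \int[marginal (dcopula C) i]_u
     (`|quantile_map mu i u - quantile_map rho i u| `^ p)%:E)%E.
Proof.
rewrite [LHS]ge0_integral_distribution; last 2 first.
- apply/measurable_EFinP; apply: (measurableT_comp (measurable_powR p)).
  apply: (measurableT_comp (@normr_measurable _ _)).
  by have := @measurable_cdiff_tnth R n i; under eq_fun do rewrite tnth_mktuple.
- by move=> z; rewrite lee_fin powR_ge0.
rewrite (integral_dcopula_marginal
  (f := fun u => `|quantile_map mu i u - quantile_map rho i u| `^ p))//.
by apply: eq_integral => u _ /=; rewrite !tnth_mktuple.
Qed.

(** A coupling projects on the i-th coordinates to a coupling of [mu_i] and [rho_i]. These are the
    laws of the two quantile functions under the i-th marginal of [dC], so the one-dimensional
    inequality applies to each term of the sum. *)
Lemma diamond_optimal p nu : 1 <= p -> is_coupling mu rho nu ->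
  (transport_integral p p (diamond mu rho C) <= transport_integral p p nu)%E.
Proof.
move=> p1 nuC; have p0 : 0 < p by rewrite (lt_le_trans ltr01).
rewrite !transport_integral_sum//; apply: lee_sum => i _.
rewrite integral_diamond_coord.
have mpre A : measurable A -> measurable [set x : n.-tuple R | A (tnth x i)].
  by move=> mA; rewrite -[X in measurable X]setTI; exact: measurable_tnth.
apply: (@monotone_transport_le R (marginal (dcopula C) i) _ _ _ nu
  (quantile_map mu i) (quantile_map rho i) (fst_coord i) (snd_coord i)) => //.
- exact: dcopula_marginal_oo.
- exact: quantile_homo.
- exact: quantile_homo.
- move=> A mA; apply/esym/(etrans (quantile_law muC _ mA)).
  by have [h _] := nuC _ (mpre _ mA); exact: (esym h).
- move=> A mA; apply/esym/(etrans (quantile_law rhoC _ mA)).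
  by have [_ h] := nuC _ (mpre _ mA); exact: (esym h).
Qed.

Lemma wasserstein_diamond p : 1 <= p ->
  wasserstein p p mu rho = transport_cost p p (diamond mu rho C).
Proof.
move=> p1; apply/eqP; rewrite eq_le; apply/andP; split.
  by apply: ereal_inf_lbound; exists (diamond mu rho C) => //; exact: diamond_coupling.
apply: le_ereal_inf_tmp => _ [nu nuC <-]; rewrite !transport_costE.
apply: gt0_ler_poweR; rewrite ?in_itv/= ?andbT ?leey ?transport_integral_ge0//.
  by rewrite invr_ge0 (le_trans ler01).
exact: diamond_optimal.
Qed.

Lemma wasserstein_powR p : 1 <= p ->
  (wasserstein p p mu rho `^ p = transport_integral p p (diamond mu rho C))%E.
Proof.
move=> p1; rewrite wasserstein_diamond// transport_costE -poweRrM mulVf.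
  by rewrite poweRe1// transport_integral_ge0.
by rewrite gt_eqF// (lt_le_trans ltr01).
Qed.

Lemma transport_integral_diamond p : 1 <= p ->
  (transport_integral p p (diamond mu rho C) =
   \int[dcopula C]_(u in unit_cube n)
     (\sum_(i < n) `|quantile (marginal mu i) (tnth u i)
                     - quantile (marginal rho i) (tnth u i)| `^ p)%:E)%E.
Proof.
move=> p1; have p0 : 0 < p by rewrite (lt_le_trans ltr01).
have mc : measurable (@unit_cube R n).
  rewrite (_ : unit_cube n = [set u | forall i, `[0, 1]%classic (tnth u i)]).
    by apply: (measurable_box (I := fun=> `[0, 1]%classic)) => i; exact: measurable_itv.
  by apply/seteqP; split => u h i; have := h i; rewrite /= in_itv.
pose mcost i := measurable_cost (quantile_map mu i) (quantile_map rho i) p.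
have mf : measurable_fun setT (fun u : n.-tuple R =>
    (\sum_(i < n) `|quantile (marginal mu i) (tnth u i)
                   - quantile (marginal rho i) (tnth u i)| `^ p)%:E).
  apply/measurable_EFinP; apply: measurable_sum => i.
  exact: (measurableT_comp (mcost i) (measurable_tnth i)).
have f0 u : (0 <= (\sum_(i < n) `|quantile (marginal mu i) (tnth u i)
                   - quantile (marginal rho i) (tnth u i)| `^ p)%:E)%E.
  by rewrite lee_fin sumr_ge0// => i _; exact: powR_ge0.
(* The complement of the cube is null for [dC], so the integral can be taken over the whole
   space. *)
transitivity (\int[dcopula C]_u
     (\sum_(i < n) `|quantile (marginal mu i) (tnth u i)
                     - quantile (marginal rho i) (tnth u i)| `^ p)%:E)%E; last first.
  rewrite (@ge0_negligible_integral _ _ _ _ setT (~` unit_cube n))//; last 2 first.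
  - exact: measurableC.
  - rewrite (_ : ~` _ = [set u | exists i, (~` `[0, 1]%classic) (tnth u i)]).
      apply: (dcopula_coord_null C (N := fun=> ~` `[0, 1]%classic)) => i.
        by apply: measurableC; exact: measurable_itv.
      by rewrite setICl measure0.
    apply/seteqP; split => u /=; first by move=> /existsNP[i h]; exists i; rewrite in_itv.
    by move=> [i]; rewrite in_itv => h /(_ i).
  by rewrite setTD setCK.
rewrite transport_integral_sum// ge0_integral_sumEFin//; last first.
  by move=> i; exact: (measurableT_comp (mcost i) (measurable_tnth i)).
apply: eq_bigr => i _; rewrite integral_diamond_coord.
exact: (integral_dcopula_marginal i (mcost i) (fun u => powR_ge0 _ _)).
Qed.

Lemma transport_integral_diamond_lebesgue p : 1 <= p ->
  (transport_integral p p (diamond mu rho C) =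
   \int[lebesgue_measure]_(u in `[0%R, 1%R])
     (\sum_(i < n) `|quantile (marginal mu i) u
                     - quantile (marginal rho i) u| `^ p)%:E)%E.
Proof.
move=> p1; have p0 : 0 < p by rewrite (lt_le_trans ltr01).
pose mcost i := measurable_cost (quantile_map mu i) (quantile_map rho i) p.
rewrite transport_integral_sum// [RHS]ge0_integral_sumEFin//.
apply: eq_bigr => i _; rewrite integral_diamond_coord.
have mN : measurable (~` `[0, 1]%classic : set R).
  by apply: measurableC; exact: measurable_itv.
have N0 : marginal (dcopula C) i (~` `[0, 1]) = 0%E.
  by rewrite dcopula_marginal// setICl measure0.
have mf : measurable_fun setT
    (fun u : R => (`|quantile_map mu i u - quantile_map rho i u| `^ p)%:E).
  by apply/measurable_EFinP; exact: (mcost i).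
have f0 u : setT u -> (0 <= (`|quantile_map mu i u - quantile_map rho i u| `^ p)%:E)%E.
  by move=> _; rewrite lee_fin powR_ge0.
rewrite (ge0_negligible_integral mN measurableT mf f0 N0).
rewrite setTD setCK.
(* Lebesgue measure lives on measurableTypeR R, a copy of R. *)
pose phi : R -> measurableTypeR R := id.
have mphi : measurable_fun setT phi by move=> _ A mA; rewrite setTI.
transitivity (\int[pushforward (marginal (dcopula C) i) phi]_(x in `[0%R, 1%R])
      (`|quantile_map mu i x - quantile_map rho i x| `^ p)%:E)%E.
  rewrite (ge0_integral_pushforward mphi)//.
  by apply: measurable_funTS => _ A mA; exact: (mf measurableT A mA).
apply: eq_measure_integral => A mA A01.
by apply: (etrans (dcopula_marginal C i mA)); rewrite setIidl.
Qed.

End optimality.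

(** * The case p <> q *)

(** The default measure [P] is the value of [mnormalize] only for total mass 0 or infinity, both
    excluded here. *)
Lemma mnormalizeE d (T : measurableType d) (R : realType)
    (mu : {measure set T -> \bar R}) (P : probability T R) (r : R) :
  mu setT = r%:E -> r != 0 -> forall A, mnormalize mu P A = (mu A * r^-1%:E)%E.
Proof.
move=> muT r0 A; rewrite /mnormalize muT/= ifF//.
by apply/negbTE; rewrite negb_or/= andbT eqe.
Qed.

(** * Coupling two events of probability one half *)

Section half_coupling.
Context d1 d2 (T1 : measurableType d1) (T2 : measurableType d2) (R : realType).
Variables (m1 : probability T1 R) (m2 : probability T2 R).

(** The product measure is conditioned on [S], where x is in E exactly when y is in F. S has mass
    1/4 + 1/4. The first marginal survives since A has conditional measure
    [2 * (m1 (A & E) / 2 + m1 (A \ E) / 2)], and the second likewise. *)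
Lemma half_coupling (E : set T1) (F : set T2) :
  measurable E -> measurable F -> m1 E = 2^-1%:E -> m2 F = 2^-1%:E ->
  exists nu : probability (T1 * T2)%type R,
    [/\ forall A, measurable A -> nu (fst @^-1` A) = m1 A,
        forall A, measurable A -> nu (snd @^-1` A) = m2 A,
        nu (E `*` F) = 2^-1%:E & nu (~` E `*` ~` F) = 2^-1%:E].
Proof.
move=> mE mF E2 F2.
have mEC : measurable (~` E) by exact: measurableC.
have mFC : measurable (~` F) by exact: measurableC.
have half : (1 - (2^-1)%:E = 2^-1%:E :> \bar R)%E by rewrite -EFinB; congr EFin; lra.
have EC2 : m1 (~` E) = 2^-1%:E by rewrite probability_setC// E2.
have FC2 : m2 (~` F) = 2^-1%:E by rewrite probability_setC// F2.
pose S := (E `*` F) `|` (~` E `*` ~` F).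
have mS : measurable S by apply: measurableU; exact: measurableX.
pose m := mrestr (m1 \x m2)%E mS.
have PE A B : measurable A -> measurable B ->
    ((m1 \x m2) (A `*` B) = m1 A * m2 B)%E.
  by move=> mA mB; exact: product_measure1E.
have mXE A B : measurable A -> measurable B -> (m (A `*` B) =
    m1 (A `&` E) * m2 (B `&` F) + m1 (A `&` ~` E) * m2 (B `&` ~` F))%E.
  move=> mA mB; rewrite /m /mrestr /S setIUr -!setXI measureU.
  - by congr (_ + _)%E; apply: PE; exact: measurableI.
  - by apply: measurableX; exact: measurableI.
  - by apply: measurableX; exact: measurableI.
  - by apply/seteqP; split => // -[x y] /= [[[_ Ex] _] [[_ nEx] _]].
have mT : m setT = 2^-1%:E.
  rewrite -setXTT mXE// !setTI E2 F2 EC2 FC2 -!EFinM -EFinD; congr EFin; lra.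
pose nu := mnormalize m (m1 \x m2)%E.
have nuE A : nu A = (m A * 2%:E)%E.
  by rewrite -[X in (_ * X%:E)%E]invrK; apply: mnormalizeE => //; lra.
have nuXE A B : measurable A -> measurable B -> (nu (A `*` B) =
    2%:E * (m1 (A `&` E) * m2 (B `&` F) + m1 (A `&` ~` E) * m2 (B `&` ~` F)))%E.
  by move=> mA mB; rewrite nuE mXE// muleC.
have split_half d (T : measurableType d) (m' : probability T R) (A B : set T) :
    measurable A -> measurable B ->
    (2%:E * (m' (A `&` B) * 2^-1%:E + m' (A `&` ~` B) * 2^-1%:E) = m' A)%E.
  move=> mA mB.
  have -> : m' A = (m' (A `&` B) + m' (A `&` ~` B))%E.
    by rewrite addeC; apply: (etrans (measureDI m' mA mB)); rewrite setDE.
  have f1 : m' (A `&` B) \is a fin_num by apply: fin_num_measure; exact: measurableI.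
  have f2 : m' (A `&` ~` B) \is a fin_num.
    by apply: fin_num_measure; apply: measurableI => //; exact: measurableC.
  move: f1 f2; case: (m' _) => // x _; case: (m' _) => // y _.
  by rewrite -!EFinM; congr EFin; field.
exists nu; split => [A mA|A mA||].
- have := nuXE _ _ mA (@measurableT _ T2).
  rewrite setXT !setTI F2 FC2 => h; apply: (etrans h); exact: split_half.
- have := nuXE _ _ (@measurableT _ T1) mA.
  rewrite setTX !setTI E2 EC2 => h; apply: (etrans h).
  by rewrite -[RHS](split_half _ _ m2 A F)// !(muleC 2^-1%:E).
- apply: (etrans (nuXE _ _ mE mF)).
  rewrite !setIid !setICr !measure0 E2 F2 mule0 adde0 -!EFinM; congr EFin.
  by field.
- apply: (etrans (nuXE _ _ mEC mFC)).
  rewrite !setIid !setICl !measure0 EC2 FC2 mule0 add0e -!EFinM; congr EFin.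
  by field.
Qed.

End half_coupling.

(** * Perturbed step functions *)

Section step_map.
Context (R : realType).
Implicit Types (b c : bool) (e u v x : R).

(** Keeps the perturbation between 0 and e at every real u, so the cost estimates hold at all points
    and not only on the cube. *)
Definition clamp01 u : R := Num.max 0 (Num.min u 1).

Lemma clamp01_itv u : 0 <= clamp01 u <= 1.
Proof. by rewrite /clamp01 le_max lexx/= ge_max ler01 ge_min lexx orbT. Qed.

Lemma clamp01_id u : 0 <= u <= 1 -> clamp01 u = u.
Proof. by move=> /andP[u0 u1]; rewrite /clamp01 min_l// max_r. Qed.

Lemma le_clamp01 : {homo clamp01 : u v / u <= v}.
Proof.
move=> u v uv; rewrite /clamp01 ge_max le_max lexx/= le_max; apply/orP; right.
by rewrite le_min ge_min uv/= ge_min lexx orbT.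
Qed.

(** On [0, 1], the flag b creates a unit jump at 1/2 and c lowers it by 1, giving
    [1_{u > 1/2} + e u] or [- 1_{u <= 1/2} + e u] when b holds. The strict inequality makes the
    function left continuous, like a quantile function. *)
Definition step_map b c e u : R := (b && (2^-1 < u))%:R - c%:R + e * clamp01 u.

Lemma measurable_step_map b c e : measurable_fun [set: R] (step_map b c e).
Proof.
apply: measurable_funD.
  apply: nondecreasing_measurable => // u v uv; rewrite lerB// ler_nat.
  by case: b => //=; case: ltP => // h; rewrite (lt_le_trans h uv).
apply: measurable_funM => //; apply: nondecreasing_measurable => //.
exact: le_clamp01.
Qed.

HB.instance Definition _ b c e :=
  @isMeasurableFun.Build _ _ _ _ (step_map b c e) (measurable_step_map b c e).

Lemma lt_step_map b c e : 0 < e -> {in `[0, 1] &, {homo step_map b c e : u v / u < v}}.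
Proof.
move=> e0 u v; rewrite !in_itv/= => u01 v01 uv.
rewrite /step_map !clamp01_id// ler_ltD//; last by rewrite ltr_pM2l.
rewrite lerB// ler_nat.
by case: b => //=; case: ltP => // h; rewrite (lt_trans h uv).
Qed.

Lemma step_map_left_continuous b c e u x : (0 < e) -> 0 < u < 1 ->
  x < step_map b c e u -> exists2 v, 0 < v < u & x < step_map b c e v.
Proof.
move=> e0 /andP[u0 u1] xu.
(* The jump term is constant on ]w, u]. *)
pose w : R := if 2^-1 < u then 2^-1 else 0.
have w0 : 0 <= w by rewrite /w; case: ifP => // _; rewrite invr_ge0.
have wu : w < u by rewrite /w; case: ifP.
have sE v : w < v -> v <= u -> (2^-1 < v) = (2^-1 < u).
  rewrite /w; have [u2 wv _|u2 _ vu] := ltP 2^-1 u; first by rewrite wv.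
  by apply/negbTE; rewrite -leNgt (le_trans vu).
(* Moving left by d stays above w and lowers the value by [e * d], at most half of the available
   margin. *)
pose d := Num.min ((u - w) / 2) ((step_map b c e u - x) / (2 * e)).
have d0 : 0 < d.
  by rewrite /d lt_min !divr_gt0 ?subr_gt0// mulr_gt0.
have dw : d <= (u - w) / 2 by rewrite /d ge_min lexx.
have de : e * d <= (step_map b c e u - x) / 2.
  have : d <= (step_map b c e u - x) / (2 * e) by rewrite /d ge_min lexx orbT.
  rewrite -(ler_pM2l e0) => /le_trans; apply.
  by rewrite le_eqVlt; apply/orP; left; apply/eqP; field; rewrite gt_eqF.
have wd : w < u - d by lra.
exists (u - d); first by apply/andP; split; lra.
have : step_map b c e (u - d) = step_map b c e u - e * d.
  rewrite /step_map sE//; last by rewrite lerBlDr lerDl ltW.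
  rewrite !clamp01_id; first by ring.
    by rewrite !ltW.
  by apply/andP; split; lra.
by move=> ->; lra.
Qed.

End step_map.

(** * Cost of the perturbed steps *)

Section step_coupling.
Context (R : realType) (n : nat) (i0 i1 : 'I_n) (c : bool) (e : R).
Hypothesis i01 : i0 != i1.
Hypothesis e0 : 0 < e.

Definition step_source (i : 'I_n) : {mfun R >-> R} := step_map (i == i0) false e.
Definition step_target (i : 'I_n) : {mfun R >-> R} :=
  step_map (i == i1) ((i == i1) && c) e.

(** The absolute difference of the i-th coordinates for e = 0, which is always 0 or 1. *)
Definition step_gap (u v : n.-tuple R) (i : 'I_n) : bool :=
  if i == i0 then 2^-1 < tnth u i0
  else (i == i1) && ((2^-1 < tnth v i1) (+) c).

Definition step_pair (u v : n.-tuple R) :=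
  (coord_map step_source u, coord_map step_target v).

Lemma step_gap_bounds u v i :
  (step_gap u v i)%:R - e <= `|tnth (cdiff (step_pair u v)) i|
    <= (step_gap u v i)%:R + e.
Proof.
have /andP[a0 a1] := clamp01_itv (tnth u i).
have /andP[b0 b1] := clamp01_itv (tnth v i).
have ab : `|e * clamp01 (tnth u i) - e * clamp01 (tnth v i)| <= e.
  rewrite -mulrBr normrM gtr0_norm//; apply: ler_piMr; first exact: ltW.
  by rewrite ler_norml; apply/andP; split; lra.
(* The coordinate difference without its e-terms, which together contribute at most e in absolute
   value. *)
pose s : R := (((i == i0) && (2^-1 < tnth u i))%:R - false%:R) -
  (((i == i1) && (2^-1 < tnth v i))%:R - ((i == i1) && c)%:R).
have -> : tnth (cdiff (step_pair u v)) i =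
    s + (e * clamp01 (tnth u i) - e * clamp01 (tnth v i)).
  by rewrite !tnth_mktuple/= /step_map /s; ring.
have -> : (step_gap u v i)%:R = `|s|.
  rewrite /s /step_gap; have [->|ni0] := eqVneq i i0.
    by rewrite (negbTE i01)/= !subr0 normr_nat.
  have [->|ni1] /= := eqVneq i i1; last by rewrite !subr0 normr0.
  by case: (2^-1 < _); case: (c);
    rewrite /= ?subrr ?subr0 ?sub0r ?normrN ?opprK ?normr1 ?normr0.
apply/andP; split; last by rewrite (le_trans (ler_normD _ _))// lerD2l.
by rewrite (le_trans _ (lerB_normD _ _))// lerB.
Qed.

Definition step_gaps (u v : n.-tuple R) : nat :=
  ((2^-1 < tnth u i0)%R + ((2^-1 < tnth v i1)%R (+) c))%N.

Lemma sum_step_gap u v : (\sum_(i < n) (step_gap u v i)%:R = (step_gaps u v)%:R :> R).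
Proof.
rewrite (bigD1 i0)//= (bigD1 i1)/= 1?eq_sym// big1 ?addr0.
  rewrite /step_gap/step_gaps !eqxx /= (negbTE (_ : i1 != i0)) 1?eq_sym//.
  by rewrite natrD.
by move=> i /andP[ni0 ni1]; rewrite /step_gap (negbTE ni0) (negbTE ni1).
Qed.

(** Every nonzero gap adds at least [(1 - e)^q] to the sum defining the norm. *)
Lemma step_cost_ge p q u v : 0 <= p -> 1 <= q -> e < 1 ->
  (step_gaps u v)%:R `^ (p / q) * (1 - e) `^ p <=
  lnorm q (cdiff (step_pair u v)) `^ p.
Proof.
move=> p0 q1 e1; have q0 : 0 < q by rewrite (lt_le_trans ltr01).
have e1' : 0 <= 1 - e by rewrite subr_ge0 ltW.
have -> : (1 - e) `^ p = ((1 - e) `^ q) `^ (p / q).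
  by rewrite -powRrM mulrC divfK ?gt_eqF.
rewrite lnorm_powR -powRM ?powR_ge0//.
apply: ge0_ler_powR; rewrite ?nnegrE; [exact: divr_ge0 (ltW q0)|
  by rewrite mulr_ge0 ?powR_ge0| by apply: sumr_ge0 => i _; exact: powR_ge0|].
rewrite -sum_step_gap mulr_suml; apply: ler_sum => i _.
have q0' := ltW q0.
have /andP[+ _] := step_gap_bounds u v i.
case: (step_gap u v i) => h; last by rewrite mul0r powR_ge0.
by rewrite mul1r; apply: ge0_ler_powR; rewrite ?nnegrE.
Qed.

(** Each coordinate adds at most [(gap + e) (1 + e)^q]: for a gap 1 this dominates [(1 + e)^q], for
    a gap 0 it dominates [e^q], because [e^q <= e] when q >= 1 and e < 1. Summing the n terms e
    gives [n e]. *)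
Lemma step_cost_le p q u v : 0 <= p -> 1 <= q -> e < 1 ->
  lnorm q (cdiff (step_pair u v)) `^ p <=
  ((step_gaps u v)%:R + n%:R * e) `^ (p / q) * (1 + e) `^ p.
Proof.
move=> p0 q1 e1; have q0 : 0 < q by rewrite (lt_le_trans ltr01).
have e1' : 0 <= 1 + e by rewrite addr_ge0// ltW.
have -> : (1 + e) `^ p = ((1 + e) `^ q) `^ (p / q).
  by rewrite -powRrM mulrC divfK ?gt_eqF.
have ne0 : 0 <= (step_gaps u v)%:R + n%:R * e by rewrite addr_ge0// mulr_ge0// ltW.
rewrite lnorm_powR -powRM ?powR_ge0//.
apply: ge0_ler_powR; rewrite ?nnegrE; [exact: divr_ge0 (ltW q0)|
  by apply: sumr_ge0 => i _; exact: powR_ge0|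
  by rewrite mulr_ge0 ?powR_ge0|].
have -> : n%:R * e = \sum_(i < n) e by rewrite sumr_const card_ord mulr_natl.
rewrite -sum_step_gap -big_split mulr_suml; apply: ler_sum => i _ /=.
have /andP[_] := step_gap_bounds u v i.
have q0' := ltW q0.
have ge1 : 1 <= (1 + e) `^ q.
  suff : 1 `^ q <= (1 + e) `^ q by rewrite powR1.
  by apply: ge0_ler_powR; rewrite ?nnegrE// lerDl ltW.
case: (step_gap u v i) => h.
  apply: (@le_trans _ _ ((1 + e) `^ q)).
    by apply: ge0_ler_powR; rewrite ?nnegrE.
  by rewrite ler_peMl ?powR_ge0// lerDl ltW.
rewrite add0r in h *.
apply: (@le_trans _ _ (e `^ q)).
  by apply: ge0_ler_powR; rewrite ?nnegrE// ltW.
apply: (@le_trans _ _ e); first by apply: ge1r_powR => //; rewrite e0 ltW.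
by rewrite ler_peMr// ltW.
Qed.

End step_coupling.

(** At e = 0 the inequality is the hypothesis, and continuity extends it to small e > 0. *)
Lemma perturbation_lt (R : realType) (n : nat) (t p K k1 k2 : R) :
  0 < t -> 0 < p -> 0 <= k1 -> 0 <= k2 -> (k1 `^ t + k2 `^ t) / 2 < K ->
  exists e, [/\ 0 < e, e < 1 &
    ((k1 + n%:R * e) `^ t * (1 + e) `^ p +
     (k2 + n%:R * e) `^ t * (1 + e) `^ p) / 2
    < (1 - e) `^ p * K].
Proof.
move=> t0 p0 k10 k20 kK.
(* [ppow] replaces the power so that D is also continuous where a base vanishes or is negative; for
   0 < e < 1 the two agree. *)
pose D e := ppow p (1 - e) * K -
  (ppow t (k1 + n%:R * e) * ppow p (1 + e) +
   ppow t (k2 + n%:R * e) * ppow p (1 + e)) / 2.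
have cc (a : R) (f : R -> R) :
    0 < a -> continuous f -> continuous (fun e => ppow a (f e)).
  by move=> a0 cf e; apply: continuous_comp; [exact: cf|exact: continuous_ppow].
have ck (k : R) : continuous (fun e : R => k + n%:R * e).
  move=> e; apply: cvgD; first exact: cvg_cst.
  by apply: cvgM; [exact: cvg_cst|exact: cvg_id].
have cp : continuous (fun e : R => 1 + e).
  by move=> e; apply: cvgD; [exact: cvg_cst|exact: cvg_id].
have cm : continuous (fun e : R => 1 - e).
  by move=> e; apply: cvgB; [exact: cvg_cst|exact: cvg_id].
have cD : {for 0, continuous D}.
  apply: cvgB.
    by apply: cvgM; [exact: (cc _ _ p0 cm 0)|exact: cvg_cst].
  apply: cvgM; last exact: cvg_cst.
  apply: cvgD; (apply: cvgM; last exact: (cc _ _ p0 cp 0)).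
    exact: (cc _ _ t0 (ck k1) 0).
  exact: (cc _ _ t0 (ck k2) 0).
have D0 : 0 < D 0.
  rewrite /D subr0 !addr0 !mulr0 !addr0 !ppow_pos// powR1 mul1r !mulr1.
  by rewrite subr_gt0.
have : \forall e \near (0 : R)^'+, [/\ 0 < e, e < 1 & 0 < D e].
  near=> e; split.
  - by near: e; exact: nbhs_right_gt.
  - by near: e; exact: nbhs_right_lt.
  near: e; apply: (cvgr_gt (D 0)) => //.
  exact: cvg_at_right_filter.
move=> /filter_ex[e [e0 e1]].
rewrite /D !ppow_pos ?subr_ge0 ?(ltW e1) ?addr_ge0 ?mulr_ge0 ?(ltW e0)//.
rewrite subr_gt0 => h; by exists e.
Unshelve. all: by end_near. Qed.

(** * Half-spaces under [dC] *)

Section half_spaces.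
Context (R : realType) (n : nat) (C : copula R n).

(** With i = i1, the event that the jump variable G selected by c is nonzero; flipping c gives the
    complement. *)
Definition upper_half (i : 'I_n) (c : bool) : set (n.-tuple R) :=
  [set u | (2^-1 < tnth u i) (+) c].

Lemma upper_halfC i c : ~` upper_half i c = upper_half i (~~ c).
Proof.
apply/seteqP; split => u; rewrite /upper_half/=.
  by move/negP; case: (_ < _); case: c.
by move=> h; apply/negP; move: h; case: (_ < _); case: c.
Qed.

Lemma measurable_upper_half i c : measurable (upper_half i c).
Proof.
have h : measurable (upper_half i false).
  rewrite (_ : upper_half i false = (fun u => tnth u i) @^-1` `]2^-1, +oo[).
    by rewrite -[X in measurable X]setTI; exact: measurable_tnth.
  by apply/seteqP; split => u; rewrite /upper_half/= in_itv/= andbT addbF.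
by case: c => //; rewrite -[true]/(~~ false) -upper_halfC; exact: measurableC.
Qed.

Lemma dcopula_upper_half i c : dcopula C (upper_half i c) = 2^-1%:E.
Proof.
have h : dcopula C (upper_half i false) = 2^-1%:E.
  rewrite (_ : upper_half i false = [set u | `]2^-1, +oo[%classic (tnth u i)]); last first.
    by apply/seteqP; split => u; rewrite /upper_half/= in_itv/= andbT addbF.
  rewrite dcopula_coord; last exact: measurable_itv.
  rewrite (_ : _ `&` _ = `]2^-1, 1]%classic).
    rewrite lebesgue_measure_itv/= lte_fin ifT; last by lra.
    by rewrite -EFinD; congr EFin; lra.
  apply/seteqP; split => u /=; rewrite !in_itv/= ?andbT.
    by move=> [-> /andP[_ ->]].
  by move=> /andP[u2 ->]; split => //; rewrite andbT; lra.
case: c => //; rewrite -[true]/(~~ false) -upper_halfC probability_setC.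
  by rewrite h -EFinB; congr EFin; lra.
exact: measurable_upper_half.
Qed.

(** The two intersections, for c false and c true, have probabilities with sum 1/2. Multiplied by s
    they average to s/4, so one of them is at least s/4, whatever the sign of s. *)
Lemma upper_half_corr (s : R) i j : exists c,
  s / 4 <= s * fine (dcopula C (upper_half i false `&` upper_half j c)).
Proof.
pose r c := fine (dcopula C (upper_half i false `&` upper_half j c)).
have mI c : measurable (upper_half i false `&` upper_half j c).
  by apply: measurableI; exact: measurable_upper_half.
have rE : r false + r true = 2^-1.
  apply: EFin_inj; rewrite EFinD !fineK ?fin_num_measure//.
  rewrite -(dcopula_upper_half i false) addeC.
  apply: esym; apply: (etrans (measureDI _ _ (measurable_upper_half j false))).
    exact: measurable_upper_half.
  by rewrite setDE upper_halfC.
have [h|h] := leP (s / 4) (s * r false); first by exists false.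
exists true; suff : s * r false + s * r true = s / 2 by rewrite -/(r true); lra.
by rewrite -mulrDr rE.
Qed.

End half_spaces.

(** * Comparing the diamond with a conditioned product *)

Section non_optimality.
Context (R : realType) (n : nat) (C : copula R n).
Variables (i0 i1 : 'I_n) (c : bool) (e p q : R).
Hypotheses (i01 : i0 != i1) (e0 : 0 < e) (e1 : e < 1) (p1 : 1 <= p) (q1 : 1 <= q).

Let phi := @step_source R n i0 e.
Let psi := @step_target R n i1 c e.
Let P := dcopula C.
Let mu : probability (n.-tuple R) R := distribution P (coord_map phi).
Let rho : probability (n.-tuple R) R := distribution P (coord_map psi).
Let E := @upper_half R n i0 false.
Let F := @upper_half R n i1 c.
Let K (z : n.-tuple R * n.-tuple R) := lnorm q (cdiff z) `^ p.
(** The bound of [step_cost_le] at a point with k nonzero gaps. *)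
Let M (k : nat) : R := (k%:R + n%:R * e) `^ (p / q) * (1 + e) `^ p.

Let p0 : 0 <= p. Proof. exact: le_trans ler01 p1. Qed.
Let mE : measurable E. Proof. exact: measurable_upper_half. Qed.
Let mF : measurable F. Proof. exact: measurable_upper_half. Qed.

Lemma step_source_unique_copula : has_unique_copula mu C.
Proof. by apply: coord_map_unique_copula => i; exact: lt_step_map. Qed.

Lemma step_target_unique_copula : has_unique_copula rho C.
Proof. by apply: coord_map_unique_copula => i; exact: lt_step_map. Qed.

Let gapsE u v : step_gaps i0 i1 c u v = ((u \in E) + (v \in F))%N.
Proof.
by congr (nat_of_bool _ + nat_of_bool _)%N; apply/idP/idP;
  rewrite inE /E /F /upper_half/= ?addbF.
Qed.

Let mK : measurable_fun setT (fun z => (K z)%:E).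
Proof. by apply/measurable_EFinP; exact: measurable_lnorm_cdiff. Qed.

Definition step_pair_map (z : n.-tuple R * n.-tuple R) : n.-tuple R * n.-tuple R :=
  step_pair i0 i1 c e z.1 z.2.

Lemma measurable_step_pair_map : measurable_fun setT step_pair_map.
Proof.
apply: measurable_fun_pair.
  exact: (measurableT_comp (measurable_coord_map phi) measurable_fst).
exact: (measurableT_comp (measurable_coord_map psi) measurable_snd).
Qed.

HB.instance Definition _ := @isMeasurableFun.Build _ _ _ _ step_pair_map
  measurable_step_pair_map.

(** [half_coupling] couples [dC] with itself along E and G, and the step maps carry the result to a
    coupling of mu and rho. It charges only the images of two pieces of mass 1/2, on which the
    number of gaps is a, respectively b. *)
Lemma step_coupling_exists (G : set (n.-tuple R)) (a b : nat) :
  measurable G -> P G = 2^-1%:E ->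
  (forall u v, E u -> G v -> step_gaps i0 i1 c u v = a) ->
  (forall u v, ~ E u -> ~ G v -> step_gaps i0 i1 c u v = b) ->
  exists2 nu, is_coupling mu rho nu &
    (transport_integral p q nu <= ((M a + M b) / 2)%:E)%E.
Proof.
move=> mG G2 gapa gapb.
have [nu [nu1 nu2 nuEG nuEGC]] :=
  half_coupling mE mG (dcopula_upper_half C i0 false) G2.
exists (distribution nu step_pair_map).
  move=> A mA; split.
    apply: (nu1 (coord_map phi @^-1` A)).
    by rewrite -[X in measurable X]setTI; exact: (measurable_coord_map phi).
  apply: (nu2 (coord_map psi @^-1` A)).
  by rewrite -[X in measurable X]setTI; exact: (measurable_coord_map psi).
have mEC : measurable (~` E) by exact: measurableC.
have mGC : measurable (~` G) by exact: measurableC.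
pose A1 := E `*` G; pose A2 := ~` E `*` ~` G.
have mA1 : measurable A1 by exact: measurableX.
have mA2 : measurable A2 by exact: measurableX.
have mU : measurable (A1 `|` A2) by exact: measurableU.
have A12 : A1 `&` A2 = set0.
  by apply/seteqP; split => // -[x y] /= [[Ex _] [nEx _]].
have nuU : nu (~` (A1 `|` A2)) = 0%E.
  rewrite probability_setC// (_ : nu _ = nu A1 + nu A2)%E; last exact: measureU.
  by rewrite nuEG nuEGC -EFinD; congr EFin; lra.
have K0 z : (0 <= (K z)%:E)%E by rewrite lee_fin powR_ge0.
have mKs : measurable_fun setT (fun z => (K (step_pair_map z))%:E).
  exact: (measurableT_comp mK measurable_step_pair_map).
have TI : transport_integral p q (distribution nu step_pair_map) =
    (\int[nu]_z (K (step_pair_map z))%:E)%E.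
  exact: (ge0_integral_distribution step_pair_map mK K0).
have mUC : measurable (~` (A1 `|` A2)) by exact: measurableC.
rewrite TI (ge0_negligible_integral mUC measurableT mKs (fun z _ => K0 _) nuU).
rewrite setTD setCK.
have dA : [disjoint A1 & A2] by rewrite disj_set2E A12.
have mKA : measurable_fun (A1 `|` A2) (fun z => (K (step_pair_map z))%:E).
  exact: measurable_funTS.
rewrite (ge0_integral_setU nu mA1 mA2 mKA (fun z _ => K0 _) dA).
have bnd (A : set (n.-tuple R * n.-tuple R)) (k : nat) :
    measurable A -> nu A = 2^-1%:E ->
    (forall z, A z -> step_gaps i0 i1 c z.1 z.2 = k) ->
    (\int[nu]_(z in A) (K (step_pair_map z))%:E <= (M k / 2)%:E)%E.
  move=> mA A2' Ak.
  have -> : (M k / 2)%:E = (\int[nu]_(z in A) (M k)%:E)%E.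
    by rewrite integral_cst// [X in (_ * X)%E]A2' -EFinM.
  have mKA' : measurable_fun A (fun z => (K (step_pair_map z))%:E).
    exact: measurable_funTS.
  have mM : measurable_fun A (fun=> (M k)%:E) by exact: measurable_cst.
  have KM z : A z -> ((K (step_pair_map z))%:E <= (M k)%:E)%E.
    by move=> Az; rewrite lee_fin /M -(Ak _ Az); exact: step_cost_le.
  exact: (ge0_le_integral nu mA (fun z _ => K0 _) mKA' mM KM).
rewrite mulrDl EFinD; apply: leeD.
  by apply: bnd => // -[u v] [/= Eu Gv]; exact: gapa.
by apply: bnd => // -[u v] [/= Eu Gv]; exact: gapb.
Qed.

(** With r the probability of [E & F], exactly one gap is nonzero with probability 1 - 2r and both
    with probability r. Hence the mean of the unperturbed cost is [1 - 2r + 2^(p/q) r], and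
    [step_cost_ge] loses a factor [(1 - e)^p]. *)
Lemma diamond_step_ge :
  (((1 - e) `^ p * (1 + (2 `^ (p / q) - 2) * fine (P (E `&` F))))%:E <=
   transport_integral p q (diamond mu rho C))%E.
Proof.
have K0 z : (0 <= (K z)%:E)%E by rewrite lee_fin powR_ge0.
have TI : transport_integral p q (diamond mu rho C) =
    (\int[P]_u (K (quantile_pair mu rho u))%:E)%E.
  exact: (ge0_integral_distribution (quantile_pair mu rho) mK K0).
rewrite TI.
pose N : set (n.-tuple R) := [set u | exists i, (~` `]0, 1[%classic) (tnth u i)].
have mN : measurable N.
  apply: (measurable_box_exists (N := fun=> ~` `]0, 1[%classic)) => i.
  by apply: measurableC; exact: measurable_itv.
have N0 : P N = 0%E.
  apply: (dcopula_coord_null C (N := fun=> ~` `]0, 1[%classic)) => i.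
    by apply: measurableC; exact: measurable_itv.
  rewrite -(dcopula_marginal C i); last by apply: measurableC; exact: measurable_itv.
  exact: dcopula_marginal_oo.
have mKq : measurable_fun setT (fun u => (K (quantile_pair mu rho u))%:E).
  exact: (measurableT_comp mK (measurable_quantile_pair mu rho)).
have mKs : measurable_fun setT (fun u => (K (step_pair i0 i1 c e u u))%:E).
  apply: (measurableT_comp mK); apply: measurable_fun_pair.
    exact: (measurable_coord_map phi).
  exact: (measurable_coord_map psi).
(* Off the null set N, the quantile functions of the marginals are the step maps themselves, so the
   diamond is the law of [step_pair u u]. *)
have qE u : ~ N u -> quantile_pair mu rho u = step_pair i0 i1 c e u u.
  move=> nN; have u01 i : tnth u i \in `]0, 1[.
    by apply/negP => h; apply: nN; exists i => /= /h.
  apply: (congr2 pair); apply: eq_from_tnth => i; rewrite !tnth_mktuple.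
    apply: (@quantile_coord_map _ _ C phi i) => //; first exact: lt_step_map.
    by move=> ? ? ? ?; exact: step_map_left_continuous.
  apply: (@quantile_coord_map _ _ C psi i) => //; first exact: lt_step_map.
  by move=> ? ? ? ?; exact: step_map_left_continuous.
rewrite (ge0_negligible_integral mN measurableT mKq (fun u _ => K0 _) N0).
rewrite (@eq_integral _ _ _ P (setT `\` N)
  (fun u => (K (step_pair i0 i1 c e u u))%:E)); last first.
  by move=> u; rewrite inE => -[_ nN]; rewrite (qE u nN).
rewrite -(ge0_negligible_integral mN measurableT mKs (fun u _ => K0 _) N0).
have mEF : measurable (E `&` F) by exact: measurableI.
have mED : measurable (E `\` F) by exact: measurableD.
have mFD : measurable (F `\` E) by exact: measurableD.
pose w := 2 `^ (p / q) : R; pose r := fine (P (E `&` F)).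
have PEF : P (E `&` F) = r%:E by rewrite fineK// fin_num_measure.
have PE : P E = 2^-1%:E by exact: dcopula_upper_half.
have PF : P F = 2^-1%:E by exact: dcopula_upper_half.
have PFE : P (F `&` E) = r%:E by rewrite setIC.
have PED : P (E `\` F) = (2^-1 - r)%:E.
  apply: (etrans (measureD mE mF _)).
    exact: (le_lt_trans (probability_le1 P mE) (ltry 1)).
  by rewrite EFinB -PE -PEF.
have PFD : P (F `\` E) = (2^-1 - r)%:E.
  apply: (etrans (measureD mF mE _)).
    exact: (le_lt_trans (probability_le1 P mF) (ltry 1)).
  by rewrite EFinB -PF -PFE.
have w0 : 0 <= w by exact: powR_ge0.
have em0 : 0 <= (1 - e) `^ p by exact: powR_ge0.
have mI (A : set (n.-tuple R)) : measurable A ->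
    measurable_fun setT (fun u => (\1_A u)%:E : \bar R).
  by move=> mA; apply/measurable_EFinP; exact: measurable_indic.
have I0 (A : set (n.-tuple R)) u : (0 <= (\1_A u)%:E :> \bar R)%E by rewrite lee_fin.
(* A simple function below the cost: one value where exactly one event occurs, another where both
   do. *)
pose L (u : n.-tuple R) : \bar R := (((1 - e) `^ p)%:E *
  ((\1_(E `\` F) u)%:E + (\1_(F `\` E) u)%:E + w%:E * (\1_(E `&` F) u)%:E))%E.
have wI0 u : (0 <= w%:E * (\1_(E `&` F) u)%:E)%E by rewrite mule_ge0.
have mwI : measurable_fun setT (fun u => (w%:E * (\1_(E `&` F) u)%:E)%E).
  by apply: measurable_funeM; exact: mI.
have mDD : measurable_fun setT
    (fun u => ((\1_(E `\` F) u)%:E + (\1_(F `\` E) u)%:E)%E : \bar R).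
  by apply: emeasurable_funD; exact: mI.
have mS : measurable_fun setT (fun u => ((\1_(E `\` F) u)%:E + (\1_(F `\` E) u)%:E
    + w%:E * (\1_(E `&` F) u)%:E)%E : \bar R).
  by apply: emeasurable_funD.
have DD0 u : (0 <= (\1_(E `\` F) u)%:E + (\1_(F `\` E) u)%:E :> \bar R)%E.
  by rewrite adde_ge0.
have S0 u : (0 <= (\1_(E `\` F) u)%:E + (\1_(F `\` E) u)%:E
    + w%:E * (\1_(E `&` F) u)%:E)%E by rewrite adde_ge0.
have IE A x : measurable A -> P A = x -> (\int[P]_u (\1_A u)%:E)%E = x.
  by move=> mA <-; apply: (etrans (integral_indic P measurableT mA)); rewrite setIT.
have <- : (\int[P]_u L u)%E = ((1 - e) `^ p * (1 + (w - 2) * r))%:E.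
  rewrite (ge0_integralZl_EFin P measurableT (fun u _ => S0 u) mS em0).
  rewrite (ge0_integralD P measurableT (fun u _ => DD0 u) mDD (fun u _ => wI0 u) mwI).
  rewrite (ge0_integralD P measurableT (fun u _ => I0 _ u) (mI _ mED)
    (fun u _ => I0 _ u) (mI _ mFD)).
  rewrite (ge0_integralZl_EFin P measurableT (fun u _ => I0 _ u) (mI _ mEF) w0).
  rewrite (IE _ _ mED PED) (IE _ _ mFD PFD) (IE _ _ mEF PEF) -!EFinM; congr EFin.
  by field.
apply: (ge0_le_integral P measurableT _ _ mKs).
- by move=> u _; exact: mule_ge0.
- exact: measurable_funeM.
move=> u _; rewrite /L lee_fin.
apply: (le_trans _ (step_cost_ge c i01 e0 u u p0 q1 e1)).
rewrite mulrC ler_wpM2r// gapsE !indicE !in_setD !in_setI.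
have pq0 : p / q != 0.
  by rewrite mulf_neq0 ?invr_neq0// gt_eqF// (lt_le_trans ltr01).
case: (u \in E); case: (u \in F); rewrite /= ?mulr0 ?mulr1 ?addr0 ?add0r//.
- by rewrite powR1.
- by rewrite powR1.
- by rewrite powR_ge0.
Qed.

End non_optimality.

Lemma ltr_powR2 (R : realType) (a b : R) : a < b -> 2 `^ a < 2 `^ b.
Proof.
move=> ab; rewrite /powR gt_eqF// ltr_expR ltr_pM2r// ln_gt0//; lra.
Qed.

(** The flag c is chosen so that the diamond costs at least [(1 - e)^p (1 + s/4)], and e so small
    that the competing coupling stays strictly below this bound. *)
Lemma diamond_not_optimal (R : realType) (n : nat) (p q : R) (C : copula R n) :
  (2 <= n)%N -> 1 <= p -> 1 <= q -> p <> q ->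
  exists mu rho : probability (n.-tuple R) R,
    [/\ has_unique_copula mu C, has_unique_copula rho C
      & (wasserstein p q mu rho < transport_cost p q (diamond mu rho C))%E].
Proof.
move=> n2 p1 q1 pq.
have p0 : 0 < p by rewrite (lt_le_trans ltr01).
have q0 : 0 < q by rewrite (lt_le_trans ltr01).
pose i0 : 'I_n := Ordinal (ltnW n2); pose i1 : 'I_n := Ordinal n2.
have i01 : i0 != i1 by [].
pose t := p / q; pose s : R := 2 `^ t - 2.
have t0 : 0 < t by rewrite divr_gt0.
have two1 : 2 `^ 1 = 2 :> R by rewrite powRr1.
have [c hc] := upper_half_corr C s i0 i1.
(* Numbers of gaps on the two halves of the competitor: for p < q both jumps occur together or not
   at all, for p > q exactly one occurs. *)
pose a : nat := if p < q then 2 else 1; pose b : nat := if p < q then 0 else 1.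
(* For p < q the left side is 1 + s/2 with s < 0; for p > q it is 1 with s > 0. *)
have abK : ((a%:R : R) `^ t + (b%:R : R) `^ t) / 2 < 1 + s / 4.
  rewrite /a /b /s; have [pltq|qltp|//] := ltgtP p q.
    rewrite powR0 ?gt_eqF//.
    have : 2 `^ t < 2 `^ 1 :> R by apply: ltr_powR2; rewrite ltr_pdivrMr// mul1r.
    by rewrite two1; lra.
  rewrite powR1.
  have : 2 `^ 1 < 2 `^ t :> R by apply: ltr_powR2; rewrite ltr_pdivlMr// mul1r.
  by rewrite two1; lra.
have [e [e0 e1 he]] := perturbation_lt n t0 p0 (ler0n _ a) (ler0n _ b) abK.
exists (distribution (dcopula C) (coord_map (step_source i0 e))).
exists (distribution (dcopula C) (coord_map (step_target i1 c e))).
split; [exact: step_source_unique_copula|exact: step_target_unique_copula|].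
(* Pairing with G aligns the second jump with the first when p < q and opposes it when p > q. *)
pose G := @upper_half R n i1 (if p < q then c else ~~ c).
have GE v : G v <-> ((2^-1 < tnth v i1) (+) c) = (p < q).
  by rewrite /G /upper_half/=; case: (p < q); case: (c); case: (_ < _).
have EE (u : n.-tuple R) : upper_half i0 false u <-> (2^-1 < tnth u i0).
  by rewrite /upper_half/= addbF.
have [||||nu nuC nule] :=
  @step_coupling_exists _ _ C i0 i1 c e p q i01 e0 e1 p1 q1 G a b.
- exact: measurable_upper_half.
- exact: dcopula_upper_half.
- by move=> u v /EE Eu /GE Gv; rewrite /step_gaps Eu Gv /a; case: ifP.
- move=> u v /EE/negP/negbTE nEu nGv; rewrite /step_gaps nEu /b.
  have : ((2^-1 < tnth v i1) (+) c) != (p < q) by apply/eqP => /GE.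
  by case: (_ (+) c); case: (p < q).
have nu0 := transport_integral_ge0 p q nu.
(* The strict inequality is between the real bounds [Ma] and [Kb]; the comparisons on either side
   are weak and in the extended reals. *)
apply: (@le_lt_trans _ _ (transport_cost p q nu)).
  by apply: ereal_inf_lbound; exists nu.
rewrite !transport_costE.
set Ma : R := _ / 2 in nule; set Kb : R := (1 - e) `^ p * (1 + s / 4) in he.
have := @diamond_step_ge _ _ C i0 i1 c e p q i01 e0 e1 p1 q1.
set Id := transport_integral _ _ (diamond _ _ _) => Idge.
have Kge : (Kb%:E <= Id)%E.
  apply: le_trans Idge; rewrite lee_fin ler_wpM2l ?powR_ge0// lerD2l.
  exact: hc.
have Ma0 : 0 <= Ma by rewrite -lee_fin (le_trans nu0).
have pV0 : 0 < p^-1 by rewrite invr_gt0.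
have Kb0 : 0 < Kb by exact: le_lt_trans he.
apply: (@le_lt_trans _ _ (Ma%:E `^ p^-1)%E).
  by apply: gt0_ler_poweR; rewrite ?in_itv/= ?leey ?nu0 ?lee_fin ?Ma0// ltW.
apply: (@lt_le_trans _ _ (Kb%:E `^ p^-1)%E).
  by rewrite !poweR_EFin lte_fin gt0_ltr_powR ?nnegrE// ltW.
apply: gt0_ler_poweR; rewrite ?in_itv/= ?leey ?lee_fin ?(ltW Kb0)// ?(ltW pV0)//.
by rewrite (le_trans _ Kge)// lee_fin ltW.
Qed.

Theorem proposition1p1 (R : realType) (n : nat) (p q : R)
    (hn : (2 <= n)%N) (hp : 1 <= p) (hq : 1 <= q) :
  (p = q ->
   forall (mu rho : probability (n.-tuple R) R) (C : copula R n),
     has_copula mu C -> has_copula rho C ->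
     [/\ is_coupling mu rho (diamond mu rho C),
         transport_cost p p (diamond mu rho C) = wasserstein p p mu rho,
         (wasserstein p p mu rho `^ p)%E =
           (\int[dcopula C]_(u in unit_cube n)
             (\sum_(i < n) `|quantile (marginal mu i) (tnth u i)
                             - quantile (marginal rho i) (tnth u i)| `^ p)%:E)%E
       & (wasserstein p p mu rho `^ p)%E =
           (\int[lebesgue_measure]_(u in `[0%R, 1%R])
             (\sum_(i < n) `|quantile (marginal mu i) u
                             - quantile (marginal rho i) u| `^ p)%:E)%E]) /\
  (p <> q ->
   forall C : copula R n,
     (p < q /\ ~ {in unit_cube n, C =1 @copula_plus R n}) \/
     (q < p /\ ((3 <= n)%N \/
                (n = 2%N /\ ~ {in unit_cube n, C =1 @copula2_minus R n}))) ->
     exists mu rho : probability (n.-tuple R) R,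
       [/\ has_unique_copula mu C, has_unique_copula rho C
         & (wasserstein p q mu rho < transport_cost p q (diamond mu rho C))%E]).
Proof.
split => [_ mu rho C muC rhoC|pq C _]; last exact: diamond_not_optimal.
split.
- exact: diamond_coupling.
- by rewrite (wasserstein_diamond muC rhoC).
- by rewrite (wasserstein_powR muC rhoC)//; exact: transport_integral_diamond.
- rewrite (wasserstein_powR muC rhoC)//.
  exact: transport_integral_diamond_lebesgue.
Qed.
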